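(* Let $S$ be a standard graded Koszul algebra over a field $k$, and let $R=S/I$ denote a residual graded algebra (with $I\subset S$ a homogeneous ideal), with $p:=\mathrm{pdim}_S(R)$, possibly infinite. Then, for any $i\geq 0$: (1) $t_i^S(R)\leq 2i+\sum_{j=2}^{i+1}\mathrm{reg}_j^R(k)$. (2) $\mathrm{reg}_i^S(R)\leq \mathrm{reg}_{i-1}^S(R)+\mathrm{reg}_{i+1}^R(k)+1$. (3) $\mathrm{reg}_{i+1}^R(k)\leq \mathrm{reg}_i^S(R)+\mathrm{reg}_{i-1}^R(k)-1$ for $i\leq p$; and $\mathrm{reg}_{i+1}^R(k)\leq \mathrm{reg}_p^S(R)+\mathrm{reg}_{i-1}^R(k)-1$ for $i\geq p$, provided $p<\infty$. (4) If $\mathrm{reg}^S(R)=1$, then $R$ is a Koszul algebra.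
   Context: For a Noetherian graded ring $A$ over a field $k$, a finitely generated graded $A$-module $N$ and an integer $i\ge 0$, set $t_i^A(N):=\sup\{j\in\mathbb{Z}\mid \mathrm{Tor}_i^A(k,N)_j\neq 0\}$. For an integer $n$, $\mathrm{reg}_n^A(N):=\max\{t_i^A(N)-i\mid i\le n\}$, and $\mathrm{reg}^A(N):=\max_n\{\mathrm{reg}_n^A(N)\}$. The graded ring $A$ is a Koszul algebra over $k$ if $\mathrm{reg}^A(k)=0$. $\mathrm{pdim}_A(N)$ is the projective dimension of $N$ over $A$.
   Formalization: (2) and (3) are stated for i ≥ 1 only, as reg_{-1} is a max over the empty set; (3) also assumes that I is not generated by linear forms or that reg_i^S(R) > 0 (resp. reg_p^S(R) > 0), since it fails e.g. for I = 0. *)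

(* Defs.v *)
From HB Require Import structures.
From mathcomp Require Import all_boot all_order all_algebra.
From mathcomp Require Import boolp classical_sets constructive_ereal.

Set Implicit Arguments.
Unset Strict Implicit.
Unset Printing Implicit Defensive.

Import Order.TTheory GRing.Theory Num.Theory.
Local Open Scope classical_set_scope.
Local Open Scope ring_scope.

(* V is the direct sum of its subgroups G j, for j ranging over the integers. *)
Definition is_grading (V : zmodType) (G : int -> set V) : Prop :=
  [/\ forall j, G j 0 /\ (forall x y, G j x -> G j y -> G j (x - y)),
      forall v, exists s : seq int, exists f : int -> V,
        [/\ uniq s, forall j, G j (f j) & v = \sum_(j <- s) f j]
    & forall (s : seq int) (f : int -> V), uniq s ->
        (forall j, G j (f j)) -> \sum_(j <- s) f j = 0 ->
        forall j, j \in s -> f j = 0].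

(* Commutative nonnegatively graded k-algebras with degree 0 part k.  Degrees
   are integers, so that the same indexing serves algebras and modules.  The
   ring is nonzero, as comAlgType demands 1 != 0. *)
Record gradedAlg (k : fieldType) := GradedAlg {
  galg :> comAlgType k;
  gpart : int -> set galg;
  gpart_grading : is_grading gpart;
  gpart_mul : forall i j a b, gpart i a -> gpart j b -> gpart (i + j) (a * b);
  gpart_neg : forall j a, j < 0 -> gpart j a -> a = 0;
  gpart0 : forall a, gpart 0 a <-> exists c : k, a = c%:A }.

(* Finitely many elements of degree 1 generate A as a k-algebra. *)
Definition standard_graded (k : fieldType) (A : gradedAlg k) : Prop :=
  exists s : seq A, (forall a, a \in s -> gpart 1 a) /\
    forall B : {pred A}, GRing.subalg_closed B -> {subset s <= B} ->
      forall a, a \in B.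

(* The ideal A_+ of sums of homogeneous elements of positive degree. *)
Definition irrelevant (k : fieldType) (A : gradedAlg k) : set A :=
  [set a | exists s : seq (int * A),
    (forall p, p \in s -> 0 < p.1 /\ gpart p.1 p.2) /\ a = \sum_(p <- s) p.2].

(* The augmentation A -> A / A_+ = k. *)
Definition aug (k : fieldType) (A : gradedAlg k) (a : A) : k :=
  xget 0 [set c : k | irrelevant (a - c%:A)].

Section Augmentation.
Variables (k : fieldType) (A : gradedAlg k).
Implicit Types (a b x y : A) (c : k).

Let part0 j : gpart j (0 : A).
Proof. by have [h _ _] := gpart_grading A; have [] := h j. Qed.

Let partB j x y : gpart j x -> gpart j y -> gpart j (x - y).
Proof. by have [h _ _] := gpart_grading A; have [_] := h j; apply. Qed.

Let partN j x : gpart j x -> gpart j (- x).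
Proof. by rewrite -sub0r; apply: partB. Qed.

Let partD j x y : gpart j x -> gpart j y -> gpart j (x + y).
Proof. by move=> hx hy; rewrite -[y]opprK; apply: partB => //; apply: partN. Qed.

Lemma irrelevant0 : irrelevant (0 : A).
Proof. by exists [::]; rewrite big_nil. Qed.

Lemma irrelevantD x y : irrelevant x -> irrelevant y -> irrelevant (x + y).
Proof.
move=> [s [hs ->]] [t [ht ->]]; exists (s ++ t); rewrite big_cat; split=> // p.
by rewrite mem_cat => /orP[/hs|/ht].
Qed.

Lemma irrelevantN x : irrelevant x -> irrelevant (- x).
Proof.
move=> [s [hs ->]]; exists [seq (p.1, - p.2) | p <- s]; split=> [_ /mapP[p /hs[p0 hp] ->]|].
  by split=> //=; apply: partN.
by rewrite big_map -sumrN.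
Qed.

Lemma irrelevant_sum (I : eqType) (s : seq I) (F : I -> A) :
  (forall i, i \in s -> irrelevant (F i)) -> irrelevant (\sum_(i <- s) F i).
Proof.
move=> h; rewrite big_seq; elim/big_ind: _ => //; first exact: irrelevant0.
exact: irrelevantD.
Qed.

Lemma irrelevant_hom j x : 0 < j -> gpart j x -> irrelevant x.
Proof.
move=> j0 hx; exists [:: (j, x)]; rewrite big_seq1; split=> // p.
by rewrite inE => /eqP ->.
Qed.

Lemma irrelevantM x a : irrelevant x -> irrelevant (x * a).
Proof.
move=> [s [hs ->]]; have [_ /(_ a)[t [f [_ hf ->]]] _] := gpart_grading A.
rewrite mulr_suml; apply: irrelevant_sum => p /hs[p0 hp].
rewrite mulr_sumr; apply: irrelevant_sum => j _.
have [j0|j0] := ltP j 0; first by rewrite (gpart_neg j0 (hf j)) mulr0; apply: irrelevant0.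
by apply: (@irrelevant_hom (p.1 + j)); [apply: ltr_wpDr|apply: gpart_mul].
Qed.

Lemma irrelevant_scalar c : irrelevant (c%:A : A) -> c = 0.
Proof.
move=> [s [hs es]]; apply/eqP/negPn/negP => c0.
pose U := undup (map fst s).
pose f j : A := if j == 0 then - c%:A else \sum_(p <- s | p.1 == j) p.2.
have U0 : 0 \notin U.
  by rewrite mem_undup; apply/mapP => -[p /hs[p0 _] e]; rewrite -e ltxx in p0.
have hf j : gpart j (f j).
  rewrite /f; case: eqP => [->|_]; first by apply/partN/gpart0; exists c.
  rewrite big_seq_cond; elim/big_ind: _ => //; first exact: partD.
  by move=> p /andP[/hs[_ hp] /eqP <-].
have [_ _ /(_ (0 :: U) f)] := gpart_grading A.
rewrite /= U0 undup_uniq => /(_ isT hf) h.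
have : - c%:A = 0 :> A.
  suff /h/(_ 0 (mem_head _ _)) : \sum_(j <- 0 :: U) f j = 0 by rewrite /f eqxx.
  rewrite big_cons {1}/f eqxx es.
  have -> : \sum_(j <- U) f j = \sum_(j <- U) \sum_(p <- s | p.1 == j) p.2.
    apply: eq_big_seq => j jU; rewrite /f; case: eqP => // j0.
    by rewrite j0 (negPf U0) in jU.
  rewrite (exchange_big_dep xpredT) //= addrC; apply/eqP; rewrite subr_eq0.
  apply/eqP; apply: eq_big_seq => p ps.
  have pU : p.1 \in U by rewrite mem_undup map_f.
  rewrite -big_filter (eq_filter (a2 := pred1 p.1)) => [|j]; last exact: eq_sym.
  by rewrite filter_pred1_uniq ?undup_uniq// big_seq1.
by move/eqP; rewrite oppr_eq0 scaler_eq0 oner_eq0 orbF (negPf c0).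
Qed.

Lemma aug_exists a : exists c : k, irrelevant (a - c%:A).
Proof.
have [_ /(_ a)[s [f [us hf ->]]] _] := gpart_grading A.
have pos j : j != 0 -> irrelevant (f j).
  rewrite neq_lt => /orP[j0|j0]; last exact: irrelevant_hom (hf j).
  by rewrite (gpart_neg j0 (hf j)); apply: irrelevant0.
have [c ec] : exists c : k, f 0 = c%:A by apply/gpart0.
have [s0|s0] := boolP (0 \in s); last first.
  exists 0; rewrite scale0r subr0; apply: irrelevant_sum => j js; apply: pos.
  by apply: contraNneq s0 => <-.
exists c; rewrite (bigD1_seq 0)//= -ec addrAC subrr add0r -big_filter.
by apply: irrelevant_sum => j; rewrite mem_filter => /andP[/pos].
Qed.

Lemma augP a : irrelevant (a - (aug a)%:A).
Proof. by rewrite /aug; case: xgetP => // h; have [c /h] := aug_exists a. Qed.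

Lemma aug_unique a c : irrelevant (a - c%:A) -> aug a = c.
Proof.
move=> h; apply/eqP; rewrite -subr_eq0; apply/eqP/irrelevant_scalar.
have -> : (aug a - c)%:A = (a - c%:A) - (a - (aug a)%:A).
  by rewrite scalerBl opprB [RHS]addrC addrA subrK.
by apply: irrelevantD h _; apply: irrelevantN; apply: augP.
Qed.

Lemma aug1 : aug (1 : A) = 1.
Proof. by apply: aug_unique; rewrite scale1r subrr; apply: irrelevant0. Qed.

Lemma augD a b : aug (a + b) = aug a + aug b.
Proof.
apply: aug_unique; rewrite scalerDl opprD addrACA.
by apply: irrelevantD; apply: augP.
Qed.

Lemma augM a b : aug (a * b) = aug a * aug b.
Proof.
apply: aug_unique.
have -> : a * b - (aug a * aug b)%:A
    = (a - (aug a)%:A) * b + (b - (aug b)%:A) * (aug a)%:A.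
  rewrite !mulrBl [b * _]mulrC addrA subrK; congr (_ - _).
  by rewrite -scalerAl mul1r scalerA mulrC.
by apply: irrelevantD; apply: irrelevantM; apply: augP.
Qed.

Lemma aug_pos j a : j != 0 -> gpart j a -> aug a = 0.
Proof.
move=> j0 ha; apply: aug_unique; rewrite scale0r subr0.
move: j0; rewrite neq_lt => /orP[j0|j0]; last exact: irrelevant_hom ha.
by rewrite (gpart_neg j0 ha); apply: irrelevant0.
Qed.

End Augmentation.

Record gradedMod (k : fieldType) (A : gradedAlg k) := GradedMod {
  gmod :> lmodType A;
  mpart : int -> set gmod;
  mpart_grading : is_grading mpart;
  mpart_scale : forall i j (a : A) (x : gmod),
    gpart i a -> mpart j x -> mpart (i + j) (a *: x) }.

(* The residue field k = A / A_+ as an A-module, concentrated in degree 0. *)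
Definition residue (k : fieldType) (A : gradedAlg k) : Type := k.

Section Residue.
Variables (k : fieldType) (A : gradedAlg k).

HB.instance Definition _ := GRing.Zmodule.copy (residue A) k.

Let scale (a : A) (x : residue A) : residue A := aug a * (x : k).

Let scaleA a b x : scale a (scale b x) = scale (a * b) x.
Proof. by rewrite /scale mulrA augM. Qed.
Let scale1 : left_id 1 scale.
Proof. by move=> x; rewrite /scale aug1 mul1r. Qed.
Let scaleDr : right_distributive scale +%R.
Proof. by move=> a x y; rewrite /scale mulrDr. Qed.
Let scaleDl x : {morph scale^~ x : a b / a + b}.
Proof. by move=> a b; rewrite /scale augD mulrDl. Qed.

HB.instance Definition _ :=
  GRing.Zmodule_isLmodule.Build A (residue A) scaleA scale1 scaleDr scaleDl.

Definition residue_part (j : int) : set (residue A) :=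
  [set x | j != 0 -> x = 0].

Lemma residue_grading : is_grading residue_part.
Proof.
split=> [j|v|s f us hf sf j js].
- by split=> // x y hx hy j0; rewrite hx// hy// subrr.
- exists [:: 0], (fun j => if j == 0 then v else 0).
  by rewrite big_seq1 eqxx; split=> // j; rewrite /residue_part /=; case: eqP.
have [j0|/hf//] := eqVneq j 0; rewrite j0 in js *.
move: sf; rewrite (bigD1_seq 0)//= big1 ?addr0 // => i i0; exact: hf.
Qed.

Lemma residue_scale i j (a : A) (x : residue A) :
  gpart i a -> residue_part j x -> residue_part (i + j) (a *: x).
Proof.
move=> ha hx ij; have [i0|i0] := eqVneq i 0.
  by rewrite (hx _) ?scaler0//; rewrite i0 add0r in ij.
by rewrite /GRing.scale /= /scale (aug_pos i0 ha) mul0r.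
Qed.

Definition residueMod : gradedMod A := GradedMod residue_grading residue_scale.

End Residue.

(* R viewed as a graded module over S along a graded algebra morphism. *)
Definition restr (k : fieldType) (S R : gradedAlg k) (pi : {lrmorphism S -> R})
  : Type := R.

Section Restriction.
Variables (k : fieldType) (S R : gradedAlg k) (pi : {lrmorphism S -> R}).

HB.instance Definition _ := GRing.Zmodule.copy (restr pi) R.

Let scale (a : S) (x : restr pi) : restr pi := pi a * (x : R).

Let scaleA a b x : scale a (scale b x) = scale (a * b) x.
Proof. by rewrite /scale mulrA rmorphM. Qed.
Let scale1 : left_id 1 scale.
Proof. by move=> x; rewrite /scale rmorph1 mul1r. Qed.
Let scaleDr : right_distributive scale +%R.
Proof. by move=> a x y; rewrite /scale mulrDr. Qed.
Let scaleDl x : {morph scale^~ x : a b / a + b}.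
Proof. by move=> a b; rewrite /scale rmorphD mulrDl. Qed.

HB.instance Definition _ :=
  GRing.Zmodule_isLmodule.Build S (restr pi) scaleA scale1 scaleDr scaleDl.

Hypothesis pi_graded : forall j (a : S), gpart j a -> gpart j (pi a).

Lemma restr_scale i j (a : S) (x : restr pi) :
  gpart i a -> @gpart k R j x -> @gpart k R (i + j) (a *: x).
Proof. by move=> ha hx; apply: gpart_mul => //; apply: pi_graded. Qed.

Definition restrMod : gradedMod S :=
  @GradedMod k S (restr pi) (@gpart k R) (gpart_grading R) restr_scale.

End Restriction.

(* ... -> P 1 -> P 0 -> N -> 0 is exact. *)
Definition is_resolution (A : comNzRingType) (N : lmodType A)
    (P : nat -> lmodType A) (d : forall i, {linear P i.+1 -> P i})
    (e : {linear P 0 -> N}) : Prop :=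
  [/\ forall x, exists y, e y = x,
      forall y, e y = 0 <-> exists z, d 0 z = y
    & forall i y, d i y = 0 <-> exists z, d i.+1 z = y].

Definition projective (A : comNzRingType) (P : lmodType A) : Prop :=
  forall (M N : lmodType A) (g : {linear M -> N}) (f : {linear P -> N}),
    (forall y, exists x, g x = y) ->
    exists h : {linear P -> M}, forall x, g (h x) = f x.

(* Integer lengths, so that the zero module gets projective dimension -oo. *)
Definition pdim (A : comNzRingType) (N : lmodType A) : \bar int :=
  infimum +oo%E [set n%:E | n in [set n : int |
    exists (P : nat -> lmodType A) (d : forall i, {linear P i.+1 -> P i})
           (e : {linear P 0 -> N}),
      [/\ is_resolution d e, forall i, projective (P i)
        & forall i : nat, n < i%:Z -> forall x : P i, x = 0]]].

Section Regularity.
Variables (k : fieldType) (A : gradedAlg k).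

(* F has a basis of homogeneous elements, that is, F is a direct sum of
   shifted copies of A. *)
Definition graded_free (F : gradedMod A) : Prop :=
  exists B : set F,
    [/\ forall b, B b -> exists j, mpart j b,
        forall x, exists (s : seq F) (c : F -> A),
          (forall b, b \in s -> B b) /\ x = \sum_(b <- s) c b *: b
      & forall (s : seq F) (c : F -> A), uniq s ->
          (forall b, b \in s -> B b) -> \sum_(b <- s) c b *: b = 0 ->
          forall b, b \in s -> c b = 0].

Definition graded_free_resolution (N : gradedMod A) (F : nat -> gradedMod A)
    (d : forall i, {linear F i.+1 -> F i}) (e : {linear F 0 -> N}) : Prop :=
  [/\ is_resolution d e, forall i, graded_free (F i),
      forall i j x, mpart j x -> mpart j (d i x)
    & forall j x, mpart j x -> mpart j (e x)].

(* The submodule A_+ M of M. *)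
Definition irrelevant_mul (M : lmodType A) : set M :=
  [set x | exists s : seq (A * M),
    (forall p, p \in s -> irrelevant p.1) /\ x = \sum_(p <- s) p.1 *: p.2].

(* k (x)_A F i = F i / A_+ F i; the following are the elements of F i whose
   classes are the i-cycles, respectively the i-boundaries, of k (x)_A F. *)
Definition tensor_cycle (F : nat -> gradedMod A)
    (d : forall i, {linear F i.+1 -> F i}) (i : nat) : set (F i) :=
  match i with
  | 0%N => setT
  | i'.+1 => [set x | irrelevant_mul (d i' x)]
  end.

Definition tensor_boundary (F : nat -> gradedMod A)
    (d : forall i, {linear F i.+1 -> F i}) (i : nat) : set (F i) :=
  [set x | exists y, irrelevant_mul (x - d i y)].

(* Tor_i^A(k, N)_j != 0: the homology H_i(k (x)_A F)_j is nonzero, for F a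
   graded free resolution of N.  The choice of F is immaterial. *)
Definition Tor_neq0 (N : gradedMod A) (i : nat) (j : int) : Prop :=
  exists (F : nat -> gradedMod A) (d : forall i, {linear F i.+1 -> F i})
         (e : {linear F 0 -> N}),
    graded_free_resolution d e /\
    exists x : F i, [/\ mpart j x, tensor_cycle d x & ~ tensor_boundary d x].

Definition tor_top (N : gradedMod A) (i : nat) : \bar int :=
  supremum -oo%E [set j%:E | j in [set j : int | Tor_neq0 N i j]].

Definition reg_upto (N : gradedMod A) (n : nat) : \bar int :=
  (\big[maxe/-oo]_(i < n.+1) (tor_top N i - (i%:Z)%:E))%E.

Definition reg (N : gradedMod A) : \bar int :=
  supremum -oo%E [set reg_upto N n | n in setT].

End Regularity.

Definition Koszul (k : fieldType) (A : gradedAlg k) : Prop :=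
  reg (residueMod A) = 0%E.

Definition homogeneous_ideal (k : fieldType) (S : gradedAlg k) (I : set S) :
    Prop :=
  [/\ I 0, forall x y, I x -> I y -> I (x + y),
      forall a x, I x -> I (a * x)
    & forall x, I x -> exists (s : seq int) (f : int -> S),
        (forall j, gpart j (f j) /\ I (f j)) /\ x = \sum_(j <- s) f j].

(* pi exhibits R as the residual graded algebra S / I. *)
Record graded_quotient (k : fieldType) (S : gradedAlg k) (I : set S)
    (R : gradedAlg k) (pi : {lrmorphism S -> R}) : Prop := GradedQuotient {
  quot_surj : forall r, exists a, pi a = r;
  quot_ker : forall a, pi a = 0 <-> I a;
  quot_hom : forall j a, gpart j a -> gpart j (pi a) }.

(* I is generated by linear forms; this includes I = 0. *)
Definition linearly_generated (k : fieldType) (S : gradedAlg k) (I : set S) :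
    Prop :=
  forall x, I x -> exists s : seq (S * S),
    (forall p, p \in s -> I p.2 /\ gpart 1 p.2) /\
    x = \sum_(p <- s) p.1 * p.2.

(* Main.v *)
From HB Require Import structures.
Require Import Defs.
From mathcomp Require Import all_boot all_order all_algebra.
From mathcomp Require Import boolp classical_sets constructive_ereal.
From mathcomp Require Import zify ring.

Set Implicit Arguments.
Unset Strict Implicit.
Unset Printing Implicit Defensive.

Import Order.TTheory GRing.Theory Num.Theory.
Local Open Scope classical_set_scope.
Local Open Scope ring_scope.

(* Let K be the minimal free resolution of k over S, let G be the one of k over
   R, and let Z_p be the p-th syzygy of k in G, so that
   0 -> Z_(p+1) -> G_p -> Z_p -> 0 is exact and Z_0 = k.  Write
   T_q(M) = H_q(K (x)_S M) = Tor_q^S(k, M).  Since G_p is a direct sum of shifted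
   copies of R, T_q(G_p)_j != 0 gives a + b = j with Tor_p^R(k, k)_a != 0 and
   Tor_q^S(k, R)_b != 0.  As S is Koszul, T_q(Z_0)_j = 0 for j > q.

   Let T_i(R)_j != 0 with j > i.  Such a class comes from T_i(Z_1)_j, but not from
   T_i(G_1)_j, because the entries of G_1 -> G_0 = R lie in R_+, which annihilates
   T_i(R).  Hence T_(i-1)(Z_2)_j != 0, and the long exact sequences lead from there
   to some T_q(G_p)_j != 0 with p + q = i + 1 and p >= 2.  Conversely, a generator
   of degree j > l of G_l gives T_1(Z_(l-1))_j != 0, and since T_l(Z_0)_j = 0 the
   long exact sequences, followed in the other direction, lead to some
   T_q(G_p)_j != 0 with p + q = l - 1 and q >= 1.  These two degree bounds, which
   stand in for the change of rings spectral sequence, imply all the estimates. *)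

(** * Finitely supported families *)

(** [Tor_neq0] only asserts that some graded free resolution carries a class, so nothing can be
    transported before Tor is known not to depend on that choice. Hence all the work is done with
    [tau], the homology of the fixed complex K (x) M, and [tau_balanced] translates back and forth.
    In the place of M occur syzygies over R seen over S and, for [pdim], modules without any
    grading. Families of subsets [Z j] of one ambient module cover both, and kernels and images then
    need no new types.

    The constants come from the bidegrees. For a class of T_i(R)_j, p + q = i + 1 gives j - i = (a -
    p) + (b - q) + 1, and p >= 2 forces q <= i - 1. For a generator of G_l, p + q = l - 1 gives j -
    l = (a - p) + (b - q) - 1, and q >= 1 forces p <= l - 2. Both decompositions are available only
    strictly above the diagonal. Elsewhere the right-hand side has to be nonnegative: automatic in
    (2), whereas (3) requires regularity at least 1, which a nonlinear generator of I or the
    positivity assumption provides. *)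

Section UniqSum.
Variables (X : eqType) (V : zmodType).

Lemma sum_uniq_supp (s t : seq X) (G : X -> V) : uniq s -> uniq t ->
  (forall x, x \notin s -> G x = 0) -> (forall x, x \notin t -> G x = 0) ->
  \sum_(x <- s) G x = \sum_(x <- t) G x.
Proof.
move=> us ut hs ht.
rewrite (bigID (mem t)) /= addrC big1 ?add0r; last by move=> x /ht.
rewrite [RHS](bigID (mem s)) /= [RHS]addrC [in RHS]big1 ?add0r; last first.
  by move=> x /hs.
rewrite -[LHS]big_filter -[RHS]big_filter; apply: perm_big; apply: uniq_perm.
- exact: filter_uniq.
- exact: filter_uniq.
by move=> x; rewrite !mem_filter andbC.
Qed.

End UniqSum.

(* [fsfam X M] is the tensor product of M with the free module on X. *)
Record fsfam (X : choiceType) (M : zmodType) := Fsfam {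
  fsfun :> X -> M;
  fsfam_fin : exists s : seq X, forall x, x \notin s -> fsfun x = 0 }.

Section Fsfam.
Variables (X : choiceType).

Section Zmod.
Variables (M : zmodType).
Implicit Types (f g : fsfam X M).

Lemma fsfamP f g : (forall x, f x = g x) -> f = g.
Proof.
case: f g => [f hf] [g hg] /= /funext e; case: _ / e in hg *.
by congr Fsfam; apply: Prop_irrelevance.
Qed.

HB.instance Definition _ := gen_eqMixin (fsfam X M).
HB.instance Definition _ := gen_choiceMixin (fsfam X M).

Let zero_fin : exists s : seq X, forall x, x \notin s -> (0 : M) = 0.
Proof. by exists [::]. Qed.
Definition fs_zero := @Fsfam X M (fun=> 0) zero_fin.

Let opp_fin f : exists s : seq X, forall x, x \notin s -> - f x = 0.
Proof. by have [s h] := fsfam_fin f; exists s => x /h ->; rewrite oppr0. Qed.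
Definition fs_opp f := Fsfam (opp_fin f).

Let add_fin f g : exists s : seq X, forall x, x \notin s -> f x + g x = 0.
Proof.
have [s h] := fsfam_fin f; have [t h'] := fsfam_fin g; exists (s ++ t) => x.
by rewrite mem_cat negb_or => /andP[/h -> /h' ->]; rewrite addr0.
Qed.
Definition fs_add f g := Fsfam (add_fin f g).

Let addA : associative fs_add.
Proof. by move=> f g h; apply: fsfamP => x /=; rewrite addrA. Qed.
Let addC : commutative fs_add.
Proof. by move=> f g; apply: fsfamP => x /=; rewrite addrC. Qed.
Let add0 : left_id fs_zero fs_add.
Proof. by move=> f; apply: fsfamP => x /=; rewrite add0r. Qed.
Let addN : left_inverse fs_zero fs_opp fs_add.
Proof. by move=> f; apply: fsfamP => x /=; rewrite addNr. Qed.

HB.instance Definition _ :=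
  GRing.isZmodule.Build (fsfam X M) addA addC add0 addN.

Lemma fsD f g x : (f + g) x = f x + g x. Proof. by []. Qed.
Lemma fsB f g x : (f - g) x = f x - g x. Proof. by []. Qed.
Lemma fs0 x : (0 : fsfam X M) x = 0. Proof. by []. Qed.

Lemma fs_sum (I : Type) (r : seq I) (P : pred I) (F : I -> fsfam X M) x :
  (\sum_(i <- r | P i) F i) x = \sum_(i <- r | P i) F i x.
Proof. by elim/big_rec2: _ => // i y1 y2 _ <-. Qed.

Let delta_fin (x : X) (m : M) :
  exists s : seq X, forall y, y \notin s -> (if y == x then m else 0) = 0.
Proof. by exists [:: x] => y; rewrite inE => /negPf ->. Qed.
Definition delta x m := Fsfam (delta_fin x m).

Lemma deltaE x m y : delta x m y = if y == x then m else 0.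
Proof. by []. Qed.

(** A chosen list that may contain zeros of [f]; sums over it agree with sums over any other list
    outside which [f] vanishes ([fsumE]). *)
Definition supp f : seq X := undup (sval (cid (fsfam_fin f))).

Lemma supp_uniq f : uniq (supp f). Proof. exact: undup_uniq. Qed.

Lemma suppP f x : x \notin supp f -> f x = 0.
Proof. by rewrite mem_undup; case: cid => s /= h /h. Qed.

Lemma fs_delta f : f = \sum_(x <- supp f) delta x (f x).
Proof.
apply: fsfamP => y; rewrite fs_sum.
have [ys|ys] := boolP (y \in supp f).
  rewrite (bigD1_seq y) ?supp_uniq//= eqxx big1 ?addr0// => x.
  by rewrite eq_sym => /negPf ->.
rewrite (suppP ys) big1_seq // => x /andP[_ xs] /=; case: eqP => // e.
by rewrite e xs in ys.
Qed.

End Zmod.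

Section Sum.
Variables (M N : zmodType) (F : X -> M -> N).
Hypothesis FD : forall x, {morph F x : a b / a + b}.

Definition fsum (f : fsfam X M) : N := \sum_(x <- supp f) F x (f x).

Let F0 x : F x 0 = 0.
Proof. by apply: (addrI (F x 0)); rewrite -FD !addr0. Qed.

Lemma fsumE (s : seq X) (f : fsfam X M) : uniq s ->
  (forall x, x \notin s -> f x = 0) -> fsum f = \sum_(x <- s) F x (f x).
Proof.
move=> us hs; apply: sum_uniq_supp; rewrite ?supp_uniq// => x.
  by move/suppP ->.
by move/hs ->.
Qed.

Lemma fsumD f g : fsum (f + g) = fsum f + fsum g.
Proof.
pose s := undup (supp f ++ supp g).
have us : uniq s by apply: undup_uniq.
have hf x : x \notin s -> f x = 0.
  by rewrite mem_undup mem_cat negb_or => /andP[/suppP].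
have hg x : x \notin s -> g x = 0.
  by rewrite mem_undup mem_cat negb_or => /andP[_ /suppP].
rewrite (fsumE us hf) (fsumE us hg) (@fsumE s) //; last first.
  by move=> x xs; rewrite fsD hf// hg// addr0.
by rewrite -big_split /=; apply: eq_bigr => x _; rewrite FD.
Qed.

Lemma fsum_delta x m : fsum (delta x m) = F x m.
Proof.
rewrite (@fsumE [:: x])//= ?big_seq1 ?eqxx// => y.
by rewrite inE => /negPf ->.
Qed.

End Sum.

Section Lmod.
Variables (A : comNzRingType) (M : lmodType A).
Implicit Types (f g : fsfam X M) (a b : A).

Let scale_fin a f : exists s : seq X, forall x, x \notin s -> a *: f x = 0.
Proof. by have [s h] := fsfam_fin f; exists s => x /h ->; rewrite scaler0. Qed.
Definition fs_scale a f := Fsfam (scale_fin a f).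

Let scaleA a b f : fs_scale a (fs_scale b f) = fs_scale (a * b) f.
Proof. by apply: fsfamP => x /=; rewrite scalerA. Qed.
Let scale1 : left_id 1 fs_scale.
Proof. by move=> f; apply: fsfamP => x /=; rewrite scale1r. Qed.
Let scaleDr : right_distributive fs_scale +%R.
Proof. by move=> a f g; apply: fsfamP => x /=; rewrite scalerDr. Qed.
Let scaleDl f : {morph fs_scale^~ f : a b / a + b}.
Proof. by move=> a b; apply: fsfamP => x /=; rewrite scalerDl. Qed.

HB.instance Definition _ :=
  GRing.Zmodule_isLmodule.Build A (fsfam X M) scaleA scale1 scaleDr scaleDl.

Lemma fsZ a f x : (a *: f) x = a *: f x. Proof. by []. Qed.

End Lmod.

Section Map.
Variables (A : comNzRingType) (M N : lmodType A) (v : {linear M -> N}).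

Let map_fin (f : fsfam X M) :
  exists s : seq X, forall x, x \notin s -> v (f x) = 0.
Proof. by have [s h] := fsfam_fin f; exists s => x /h ->; rewrite raddf0. Qed.
Definition fmap f := Fsfam (map_fin f).

Lemma fmap_linear : linear fmap.
Proof. by move=> a f g; apply: fsfamP => x /=; rewrite linearP. Qed.
HB.instance Definition _ :=
  GRing.isLinear.Build A (fsfam X M) (fsfam X N) _ fmap fmap_linear.

Lemma fmapE f x : fmap f x = v (f x). Proof. by []. Qed.

End Map.

End Fsfam.

(** * Matrices over A and the maps they induce on families *)

Section Tensor.
Variable (A : comNzRingType).
Implicit Types (X : choiceType) (M N : lmodType A).

(** With the scalar as its argument this is linear on the regular module, so [fmap] can apply it
    entrywise to a row of a matrix. *)
Definition scalel M (m : M) (a : A^o) : M := (a : A) *: m.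
Lemma scalel_linear M (m : M) : linear (scalel m).
Proof. by move=> a b c; rewrite /scalel scalerDl scalerA. Qed.
HB.instance Definition _ M (m : M) :=
  GRing.isLinear.Build A A^o M _ (scalel m) (scalel_linear m).

Definition lcomb X M (phi : X -> M) : fsfam X A^o -> M :=
  fsum (fun x => scalel (phi x)).

Section Lcomb.
Variables (X : choiceType) (M : lmodType A) (phi : X -> M).

Let sD x : {morph scalel (phi x) : a b / a + b}.
Proof. by move=> a b; rewrite raddfD. Qed.

Lemma lcombE (s : seq X) (f : fsfam X A^o) : uniq s ->
  (forall x, x \notin s -> f x = 0) ->
  lcomb phi f = \sum_(x <- s) (f x : A) *: phi x.
Proof. exact: fsumE. Qed.

Lemma lcomb_linear : linear (lcomb phi).
Proof.
move=> a f g; rewrite /lcomb fsumD//; congr (_ + _).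
rewrite (@fsumE _ _ _ _ sD (supp f)) ?supp_uniq//; last first.
  by move=> x /suppP h; rewrite fsZ h scaler0.
rewrite scaler_sumr; apply: eq_bigr => x _.
by rewrite /scalel fsZ scalerA.
Qed.
HB.instance Definition _ :=
  GRing.isLinear.Build A (fsfam X A^o) M _ (lcomb phi) lcomb_linear.

Lemma lcomb_delta x a : lcomb phi (delta x a) = (a : A) *: phi x.
Proof. by rewrite /lcomb fsum_delta. Qed.

End Lcomb.

(* The tensor product with M of the linear map whose matrix is [phi]. *)
Definition tens X Y M (phi : X -> fsfam Y A^o) (f : fsfam X M) : fsfam Y M :=
  fsum (fun x m => fmap (scalel m) (phi x)) f.

Section Tens.
Variables (X Y : choiceType) (phi : X -> fsfam Y A^o).

Section One.
Variables (M : lmodType A).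

Let sD x : {morph (fun m : M => fmap (scalel m) (phi x)) : a b / a + b}.
Proof. by move=> a b; apply: fsfamP => y /=; rewrite /scalel scalerDr. Qed.

Lemma tensE (s : seq X) (f : fsfam X M) y : uniq s ->
  (forall x, x \notin s -> f x = 0) ->
  tens phi f y = \sum_(x <- s) (phi x y : A) *: f x.
Proof. by move=> us hs; rewrite /tens (@fsumE _ _ _ _ sD s)// fs_sum. Qed.

Lemma tensE_supp (f : fsfam X M) y :
  tens phi f y = \sum_(x <- supp f) (phi x y : A) *: f x.
Proof. by apply: tensE; [apply: supp_uniq | move=> x; apply: suppP]. Qed.

Lemma tens_linear : linear (@tens X Y M phi).
Proof.
move=> a f g; rewrite /tens fsumD//; congr (_ + _).
rewrite (@fsumE _ _ _ _ sD (supp f)) ?supp_uniq//; last first.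
  by move=> x /suppP h; rewrite fsZ h scaler0.
rewrite scaler_sumr; apply: eq_bigr => x _; apply: fsfamP => y.
by rewrite fsZ /= /scalel !scalerA mulrC.
Qed.
HB.instance Definition _ :=
  GRing.isLinear.Build A (fsfam X M) (fsfam Y M) _ (tens phi) tens_linear.

End One.

Lemma tens_lcomb (f : fsfam X A^o) : tens phi f = lcomb phi f.
Proof.
apply: fsfamP => y; rewrite tensE_supp /lcomb /fsum fs_sum.
by apply: eq_bigr => x _; rewrite fsZ /= /GRing.scale /= mulrC.
Qed.

Lemma tens_delta1 x : tens phi (delta x (1 : A^o)) = phi x.
Proof. by rewrite tens_lcomb lcomb_delta scale1r. Qed.

Lemma tens_fmap M N (v : {linear M -> N}) (f : fsfam X M) :
  tens phi (fmap v f) = fmap v (tens phi f).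
Proof.
apply: fsfamP => y; rewrite (@tensE _ (supp f)) ?supp_uniq//; last first.
  by move=> x /suppP h; rewrite fmapE h raddf0.
rewrite fmapE tensE_supp raddf_sum; apply: eq_bigr => x _.
by rewrite /= linearZ.
Qed.

End Tens.

(** By naturality ([tens_fmap]) it is enough that the product of the matrices has zero rows. *)
Lemma tens_comp0 X Y (Z : choiceType) M (phi : X -> fsfam Y A^o) (psi : Z -> fsfam X A^o)
    (f : fsfam Z M) :
  (forall z, tens phi (psi z) = 0) -> tens phi (tens psi f) = 0.
Proof.
move=> h; rewrite {2}/tens /fsum raddf_sum big1// => z _ /=.
rewrite tens_fmap h; apply: fsfamP => y.
by rewrite fmapE raddf0.
Qed.

End Tensor.

(** * Homogeneous components *)

Section Components.
Variables (V : zmodType) (G : int -> set V).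
Hypothesis gG : is_grading G.

Lemma grading0 j : G j 0.
Proof. by have [h _ _] := gG; have [] := h j. Qed.

Lemma gradingB j x y : G j x -> G j y -> G j (x - y).
Proof. by have [h _ _] := gG; have [_] := h j; apply. Qed.

(** Cutting [f] off outside [s] turns it into a function of all degrees that [v] determines, see
    [hcomp_unique]. *)
Lemma grading_decomp v : exists s : seq int, exists f : int -> V,
  [/\ uniq s, forall j, G j (f j), forall j, j \notin s -> f j = 0
    & v = \sum_(j <- s) f j].
Proof.
have [_ /(_ v)[s [f [us hf ->]]] _] := gG.
exists s, (fun j => if j \in s then f j else 0); split=> //.
- by move=> j; case: ifP => // _; apply: grading0.
- by move=> j /negPf ->.
by apply: eq_big_seq => j ->.
Qed.

Definition hcomp_support (v : V) : seq int := sval (cid (grading_decomp v)).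
Definition hcomp (v : V) : int -> V := sval (cid (svalP (cid (grading_decomp v)))).

Lemma hcompP v : [/\ uniq (hcomp_support v), forall j, G j (hcomp v j),
  forall j, j \notin hcomp_support v -> hcomp v j = 0
  & v = \sum_(j <- hcomp_support v) hcomp v j].
Proof. exact: (svalP (cid (svalP (cid (grading_decomp v))))). Qed.

Lemma hcomp_part v j : G j (hcomp v j).
Proof. by have [] := hcompP v. Qed.

Lemma hcomp_unique v (s : seq int) (f : int -> V) : uniq s ->
  (forall j, G j (f j)) -> (forall j, j \notin s -> f j = 0) ->
  v = \sum_(j <- s) f j -> hcomp v =1 f.
Proof.
move=> us hf fs ev j; have [us' hc cs' ev'] := hcompP v.
(* Listing [j] itself lets independence speak about degree [j] even if neither decomposition
   mentions it. *)
pose t := undup (j :: s ++ hcomp_support v).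
have ut : uniq t by apply: undup_uniq.
have [_ _ /(_ t (fun j => hcomp v j - f j) ut)] := gG => h.
apply/eqP; rewrite -subr_eq0; apply/eqP.
apply: (h _ _ j); last by rewrite mem_undup mem_head.
  by move=> i; apply: gradingB.
have off i : i \notin t -> (hcomp v i = 0) * (f i = 0).
  rewrite mem_undup inE mem_cat !negb_or => /and3P[_ h1 h2].
  by rewrite cs'// fs.
rewrite sumrB; apply/eqP; rewrite subr_eq0; apply/eqP.
rewrite (sum_uniq_supp ut us') => [||//]; last by move=> i /off[].
rewrite (sum_uniq_supp ut us) => [||//]; last by move=> i /off[].
by rewrite -ev -ev'.
Qed.

Lemma hcomp_hom v i : G i v -> hcomp v =1 fun j => if j == i then v else 0.
Proof.
move=> hv; apply: (@hcomp_unique _ [:: i]) => //.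
- by move=> j; case: eqP => [->//|_]; apply: grading0.
- by move=> j; rewrite inE => /negPf ->.
by rewrite big_seq1 eqxx.
Qed.

Lemma hcomp_id v i : G i v -> hcomp v i = v.
Proof. by move=> hv; rewrite (hcomp_hom hv) eqxx. Qed.

Lemma hcomp_neq v i j : G i v -> j != i -> hcomp v j = 0.
Proof. by move=> hv; rewrite (hcomp_hom hv) => /negPf ->. Qed.

Lemma part_uniq v i j : G i v -> G j v -> i != j -> v = 0.
Proof. by move=> hi hj ij; rewrite -(hcomp_id hi); apply: hcomp_neq hj ij. Qed.

Lemma hcomp_sum v (s : seq int) : uniq s -> {subset hcomp_support v <= s} ->
  v = \sum_(j <- s) hcomp v j.
Proof.
move=> us hs; have [us' _ cs ev] := hcompP v; rewrite [LHS]ev.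
apply: sum_uniq_supp => // j js; apply: cs.
by apply: contra js; apply: hs.
Qed.

Lemma gradingD j x y : G j x -> G j y -> G j (x + y).
Proof.
move=> hx hy; rewrite -[y]opprK; apply: gradingB => //.
by rewrite -sub0r; apply: gradingB => //; apply: grading0.
Qed.

Lemma hcompD v w j : hcomp (v + w) j = hcomp v j + hcomp w j.
Proof.
pose s := undup (hcomp_support v ++ hcomp_support w).
have us : uniq s by apply: undup_uniq.
apply: (@hcomp_unique _ s (fun j => hcomp v j + hcomp w j)) => // [i|i|].
- by apply: gradingD; apply: hcomp_part.
- rewrite mem_undup mem_cat negb_or => /andP[h1 h2].
  have [_ _ /(_ _ h1) -> _] := hcompP v.
  by have [_ _ /(_ _ h2) -> _] := hcompP w; rewrite addr0.
rewrite big_split /= -!hcomp_sum // => i hi; rewrite mem_undup mem_cat hi ?orbT//.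
Qed.

Lemma hcomp0 j : hcomp 0 j = 0.
Proof. by rewrite (hcomp_hom (grading0 0)) if_same. Qed.

Lemma hcompN v j : hcomp (- v) j = - hcomp v j.
Proof. by apply/eqP; rewrite -addr_eq0 -hcompD addNr hcomp0. Qed.

Lemma hcompB v w j : hcomp (v - w) j = hcomp v j - hcomp w j.
Proof. by rewrite hcompD hcompN. Qed.

Lemma hcomp_sumr (I : Type) (r : seq I) (P : pred I) (F : I -> V) j :
  hcomp (\sum_(i <- r | P i) F i) j = \sum_(i <- r | P i) hcomp (F i) j.
Proof.
by elim/big_rec2: _ => [|i y1 y2 _ <-]; rewrite ?hcomp0// hcompD.
Qed.

End Components.

Section GradedModules.
Variables (k : fieldType) (A : gradedAlg k).

Lemma hcomp_scale (M : gradedMod A) i (a : A) (x : M) j : gpart i a ->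
  hcomp (mpart_grading M) (a *: x) j = a *: hcomp (mpart_grading M) x (j - i).
Proof.
move=> ha; have [us hc cs e] := hcompP (mpart_grading M) x.
pose s := hcomp_support (mpart_grading M) x.
apply: (@hcomp_unique _ _ (mpart_grading M) _ [seq i + n | n <- s]
  (fun j => a *: hcomp (mpart_grading M) x (j - i))).
- by rewrite map_inj_uniq // => n1 n2 /addrI.
- move=> n /=; rewrite -{1}[n](subrK i) addrC; apply: mpart_scale => //.
- move=> n hn; rewrite cs ?scaler0//; apply: contra hn => hn.
  by apply/mapP; exists (n - i) => //; ring.
rewrite big_map {1}e scaler_sumr; apply: eq_bigr => n _.
by congr (_ *: hcomp _ _ _); ring.
Qed.

Lemma hcomp_map (M N : gradedMod A) (u : {linear M -> N}) x j :
  (forall i y, mpart i y -> mpart i (u y)) ->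
  hcomp (mpart_grading N) (u x) j = u (hcomp (mpart_grading M) x j).
Proof.
move=> hu; have [us hc cs e] := hcompP (mpart_grading M) x.
apply: (@hcomp_unique _ _ (mpart_grading N) _ (hcomp_support (mpart_grading M) x)
  (fun j => u (hcomp (mpart_grading M) x j))) => //.
- by move=> n; apply: hu.
- by move=> n /cs ->; rewrite raddf0.
by rewrite {1}e raddf_sum.
Qed.

End GradedModules.

(** * Tor as the homology of K (x) M, for K a resolution of k *)

Section Pregraded.
Variables (k : fieldType) (A : gradedAlg k).

(* The components Z j need not be independent: Z := fun=> setT forgets the
   grading, so that one theory of Tor serves graded and ungraded modules. *)
Definition pregraded (M : lmodType A) (Z : int -> set M) : Prop :=
  [/\ forall j, Z j 0, forall j x y, Z j x -> Z j y -> Z j (x - y)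
    & forall i j (a : A) x, gpart i a -> Z j x -> Z (i + j) (a *: x)].

Section Facts.
Variables (M : lmodType A) (Z : int -> set M).
Hypothesis pZ : pregraded Z.

Lemma pregraded0 j : Z j 0. Proof. by have [] := pZ. Qed.
Lemma pregradedB j x y : Z j x -> Z j y -> Z j (x - y).
Proof. by have [_ h _] := pZ; apply: h. Qed.
Lemma pregradedN j x : Z j x -> Z j (- x).
Proof. by rewrite -sub0r; apply: pregradedB; apply: pregraded0. Qed.
Lemma pregradedD j x y : Z j x -> Z j y -> Z j (x + y).
Proof. by move=> hx hy; rewrite -[y]opprK; apply: pregradedB (pregradedN hy). Qed.
Lemma pregradedZ i j n (a : A) x : gpart i a -> Z j x -> i + j = n -> Z n (a *: x).
Proof. by have [_ _ h] := pZ => ha hx <-; apply: h. Qed.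
Lemma pregraded_sum (I : eqType) (r : seq I) j (F : I -> M) :
  (forall i, i \in r -> Z j (F i)) -> Z j (\sum_(i <- r) F i).
Proof.
move=> h; rewrite big_seq; elim/big_ind: _ => //; first exact: pregraded0.
by move=> x y; apply: pregradedD.
Qed.

End Facts.

Lemma mpart_pregraded (M : gradedMod A) : pregraded (@mpart k A M).
Proof.
split=> [j|j x y|i j a x]; first exact: grading0 (mpart_grading M) j.
  exact: (gradingB (mpart_grading M)).
exact: mpart_scale.
Qed.

Lemma gpart_pregraded : pregraded (@gpart k A : int -> set A^o).
Proof.
split=> [j|j x y|i j a x]; first exact: grading0 (gpart_grading A) j.
  exact: (gradingB (gpart_grading A)).
exact: gpart_mul.
Qed.

Lemma setT_pregraded (M : lmodType A) : pregraded (fun=> [set: M]).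
Proof. by []. Qed.

(** The graded pieces of A_+; a [minRes] for them resolves k. *)
Definition posPart (j : int) : set A := [set a | gpart j a /\ (j <= 0 -> a = 0)].

Lemma posPart_pregraded : pregraded (posPart : int -> set A^o).
Proof.
have pA := gpart_pregraded.
split=> [j|j x y [hx x0] [hy y0]|i j a x ha [hx x0]].
- by split=> //; apply: (pregraded0 pA).
- by split=> [|j0]; [apply: (pregradedB pA)|rewrite x0// y0// subrr].
split=> [|ij]; first exact: gpart_mul.
have [i0|i0] := ltP i 0; first by rewrite (gpart_neg i0 ha) scale0r.
by rewrite x0 ?scaler0//; lia.
Qed.

(** Degree [j] of the direct sum of the shifts M(- dg x). *)
Definition chain (X : choiceType) (dg : X -> int) (M : lmodType A)
    (Z : int -> set M) (j : int) : set (fsfam X M) :=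
  [set f | forall x, Z (j - dg x) (f x)].

Section Chain.
Variables (X : choiceType) (dg : X -> int) (M : lmodType A) (Z : int -> set M).
Hypothesis pZ : pregraded Z.

Lemma chain_pregraded : pregraded (chain dg Z).
Proof.
split=> [j x|j f g hf hg x|i j a f ha hf x].
- exact: (pregraded0 pZ).
- by rewrite fsB; apply: (pregradedB pZ).
by rewrite fsZ; apply: (pregradedZ pZ ha (hf x)); ring.
Qed.

Lemma chain_delta j x m : Z (j - dg x) m -> chain dg Z j (delta x m).
Proof.
by move=> hm y; rewrite deltaE; case: eqP => [->//|_]; apply: (pregraded0 pZ).
Qed.

End Chain.

Lemma chain_fmap (X : choiceType) (dg : X -> int) (M N : lmodType A)
    (Z : int -> set M) (W : int -> set N) (v : {linear M -> N}) i j f :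
  (forall n x, Z n x -> W (n + i) (v x)) ->
  chain dg Z j f -> chain dg W (j + i) (fmap v f).
Proof. by move=> h hf x; rewrite fmapE addrAC; apply: h. Qed.

Lemma chain_lift (X : choiceType) (dg : X -> int) (M N : lmodType A)
    (Z : int -> set M) (W : int -> set N) (v : {linear M -> N}) j f :
  pregraded Z -> (forall n y, W n y -> exists2 x, Z n x & v x = y) ->
  chain dg W j f -> exists2 g, chain dg Z j g & fmap v g = f.
Proof.
move=> pZ lift hf.
(* Lifting zero values by zero keeps the lift finitely supported. *)
have /choice[g hg] : forall x, exists m,
    [/\ Z (j - dg x) m, v m = f x & f x = 0 -> m = 0].
  move=> x; have [m Zm em] := lift _ _ (hf x).
  have [f0|f0] := eqVneq (f x) 0.
    by exists 0; rewrite f0 raddf0; split=> //; apply: (pregraded0 pZ).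
  by exists m; split=> // e; rewrite e eqxx in f0.
have gfin : exists s : seq X, forall x, x \notin s -> g x = 0.
  by exists (supp f) => x /suppP fx; have [_ _ ->] := hg x.
exists (Fsfam gfin) => [x|]; first by have [] := hg x.
by apply: fsfamP => x; have [] := hg x.
Qed.

Lemma tens_chain (X Y : choiceType) (dX : X -> int) (dY : Y -> int)
    (phi : X -> fsfam Y A^o) (M : lmodType A) (Z : int -> set M) j f :
  pregraded Z -> (forall x, chain dY (@gpart k A : int -> set A^o) (dX x) (phi x)) ->
  chain dX Z j f -> chain dY Z j (tens phi f).
Proof.
move=> pZ hphi hf y; rewrite tensE_supp.
apply: (pregraded_sum pZ) => x _.
by apply: (pregradedZ pZ (hphi x y) (hf x)); ring.
Qed.

(* The matrices of a minimal free resolution of the cyclic module A / J, with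
   rank one in homological degree zero. *)
Record minRes (J : int -> set A) := MinRes {
  rX : nat -> choiceType;
  rdeg : forall q, rX q -> int;
  rphi : forall q, rX q.+1 -> fsfam (rX q) A^o;
  r0 : rX 0;
  r0_unique : forall x, x = r0;
  rdeg0 : rdeg r0 = 0;
  rphi_part : forall q (x : rX q.+1),
    chain (@rdeg q) (@gpart k A : int -> set A^o) (rdeg x) (rphi x);
  rphi_min : forall q (x : rX q.+1) (y : rX q), rdeg x = rdeg y -> rphi x y = 0;
  rphi_J : forall x : rX 1, J (rdeg x) (rphi x r0);
  r_exact0 : forall j (a : A), J j a -> exists2 f,
    chain (@rdeg 1) (@gpart k A : int -> set A^o) j f &
    tens (@rphi 0) f r0 = a;
  rphi_cx : forall q (x : rX q.+2), tens (@rphi q) (rphi x) = 0;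
  r_exact : forall q j f, chain (@rdeg q.+1) (@gpart k A : int -> set A^o) j f ->
    tens (@rphi q) f = 0 -> exists2 g,
    chain (@rdeg q.+2) (@gpart k A : int -> set A^o) j g &
    tens (@rphi q.+1) g = f }.

(* The degree j part of A_+ Z. *)
Inductive irrh (M : lmodType A) (Z : int -> set M) (j : int) : M -> Prop :=
| irrh0 : irrh Z j 0
| irrhD x y of irrh Z j x & irrh Z j y : irrh Z j (x + y)
| irrhM i a z of 0 < i & gpart i a & Z (j - i) z : irrh Z j (a *: z).

Lemma irrh_sum (M : lmodType A) (Z : int -> set M) j (I : Type) (r : seq I)
    (P : pred I) (F : I -> M) :
  (forall i, P i -> irrh Z j (F i)) -> irrh Z j (\sum_(i <- r | P i) F i).
Proof. by move=> h; elim/big_ind: _ => //; [apply: irrh0|apply: irrhD]. Qed.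

Section Tau.
Variable (K : minRes posPart).

Definition cyc (M : lmodType A) q : fsfam (rX K q) M -> Prop :=
  match q with
  | 0%N => fun=> True
  | q'.+1 => fun f => tens (@rphi _ K q') f = 0
  end.

Definition bnd (M : lmodType A) (Z : int -> set M) q j (f : fsfam (rX K q) M) :=
  exists2 g, chain (@rdeg _ K q.+1) Z j g & tens (@rphi _ K q) g = f.

(* Tor_q(k, Z)_j != 0. *)
Definition tau (M : lmodType A) (Z : int -> set M) q j :=
  exists f, [/\ chain (@rdeg _ K q) Z j f, cyc f & ~ bnd Z j f].

(* Tor_q(k, Z')_j -> Tor_q(k, Z)_j is not injective. *)
Definition tauB (M : lmodType A) (Z' Z : int -> set M) q j :=
  exists f, [/\ chain (@rdeg _ K q) Z' j f, cyc f, ~ bnd Z' j f & bnd Z j f].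

Lemma cyc_fmap (M N : lmodType A) (v : {linear M -> N}) q (f : fsfam (rX K q) M) :
  cyc f -> cyc (fmap v f).
Proof.
case: q f => //= q f h; rewrite tens_fmap h.
by apply: fsfamP => x; rewrite fmapE raddf0.
Qed.

Lemma cycB (M : lmodType A) q (f g : fsfam (rX K q) M) :
  cyc f -> cyc g -> cyc (f - g).
Proof. by case: q f g => //= q f g hf hg; rewrite raddfB /= hf hg subrr. Qed.

Lemma cyc_tens (M : lmodType A) q (f : fsfam (rX K q.+1) M) :
  cyc (tens (@rphi _ K q) f).
Proof. by case: q f => //= q f; apply: tens_comp0; apply: rphi_cx. Qed.

(** * The long exact sequence of Tor *)

Section Ses.
Variables (M N : lmodType A) (Z' Z : int -> set M) (W : int -> set N).
Variable v : {linear M -> N}.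

(** Exactness of 0 -> Z' -> Z -> W -> 0 in each degree. As Z' consists of subsets of M, there is no
    inclusion map to carry along. *)
Definition ses : Prop :=
  [/\ pregraded Z, forall j x, Z' j x <-> Z j x /\ v x = 0,
    forall j x, Z j x -> W j (v x)
    & forall j y, W j y -> exists2 x, Z j x & v x = y].

Hypothesis sesZ : ses.

Let pZ : pregraded Z. Proof. by have [] := sesZ. Qed.
Let sub X dg j (f : fsfam X M) : chain dg Z' j f -> chain dg Z j f.
Proof. by have [_ h _ _] := sesZ => hf x; have /h[] := hf x. Qed.
Let ker X dg j (f : fsfam X M) : chain dg Z' j f -> fmap v f = 0.
Proof.
by have [_ h _ _] := sesZ => hf; apply: fsfamP => x; have /h[] := hf x.
Qed.
Let kerI X dg j (f : fsfam X M) : chain dg Z j f -> fmap v f = 0 -> chain dg Z' j f.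
Proof.
have [_ h _ _] := sesZ => hf f0 x; apply/h; split=> //.
by rewrite -fmapE f0.
Qed.
Let img X dg j (f : fsfam X M) : chain dg Z j f -> chain dg W j (fmap v f).
Proof. by have [_ _ h _] := sesZ => hf x; apply: h. Qed.
Let lift X dg j (f : fsfam X N) : chain dg W j f ->
  exists2 g, chain dg Z j g & fmap v g = f.
Proof. by have [_ _ _ h] := sesZ; apply: chain_lift. Qed.
Let tch q j (f : fsfam _ M) : chain (@rdeg _ K q.+1) Z j f ->
  chain (@rdeg _ K q) Z j (tens (@rphi _ K q) f).
Proof. by apply: tens_chain => // x; apply: rphi_part. Qed.

Lemma tau_quot0 j : tau W 0 j -> tau Z 0 j.
Proof.
move=> [f [hf _ nf]]; have [w hw ew] := lift hf; exists w; split=> //.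
move=> [g hg eg]; apply: nf; exists (fmap v g); first exact: img.
by rewrite tens_fmap eg.
Qed.

(* The second alternative is that the connecting homomorphism does not kill
   the class of f. *)
Lemma cyc_lift q j f : chain (@rdeg _ K q.+1) W j f -> cyc f ->
  (exists w, [/\ chain (@rdeg _ K q.+1) Z j w, cyc w & fmap v w = f]) \/
  tauB Z' Z q j.
Proof.
move=> hf cf; have [w hw ew] := lift hf.
have dw : chain (@rdeg _ K q) Z' j (tens (@rphi _ K q) w).
  by apply: kerI; [apply: tch | rewrite -tens_fmap ew].
have [[u hu eu]|nb] := pselect (bnd Z' j (tens (@rphi _ K q) w)); last first.
  by right; exists (tens (@rphi _ K q) w); split=> //; [apply: cyc_tens|exists w].
left; exists (w - u); split.
- by apply: (pregradedB (chain_pregraded _ pZ)) => //; apply: sub.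
- by rewrite /= raddfB /= eu subrr.
by rewrite raddfB /= (ker hu) subr0.
Qed.

(** Exactness at T_(q+1)(W): a class that does not lift to Z has a nonzero image under the
    connecting homomorphism, and this image dies in T_q(Z). *)
Lemma tau_quotS q j : tau W q.+1 j -> tau Z q.+1 j \/ tauB Z' Z q j.
Proof.
move=> [f [hf cf nf]]; have [[w [hw cw ew]]|] := cyc_lift hf cf; last by right.
left; exists w; split=> // -[g hg eg]; apply: nf.
by exists (fmap v g); [apply: img|rewrite tens_fmap eg].
Qed.

(** Exactness at T_q(Z): the image of [f] in W bounds, and subtracting the boundary of a lifted
    bounding chain moves [f] into Z' without changing its class. *)
Lemma tau_mid q j f : ~ tau W q j -> chain (@rdeg _ K q) Z j f -> cyc f ->
  ~ bnd Z j f -> exists g, [/\ chain (@rdeg _ K q) Z' j g, cyc g & ~ bnd Z j g].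
Proof.
move=> nW hf cf nf.
have [[g hg eg]|nb] := pselect (bnd W j (fmap v f)); last first.
  by case: nW; exists (fmap v f); split=> //; [apply: img|apply: cyc_fmap].
have [h hh eh] := lift hg; have th := tch hh.
have hfh : chain (@rdeg _ K q) Z j (f - tens (@rphi _ K q) h).
  exact: (pregradedB (chain_pregraded _ pZ)).
exists (f - tens (@rphi _ K q) h); split.
- by apply: kerI => //; rewrite raddfB /= -tens_fmap eh eg subrr.
- by apply: cycB => //; apply: cyc_tens.
move=> [u hu eu]; apply: nf; exists (u + h).
  exact: (pregradedD (chain_pregraded _ pZ)).
by rewrite raddfD /= eu subrK.
Qed.

(** The connecting homomorphism read backwards: a chain of Z bounding [f] maps to a cycle of W, and
    if that cycle were a boundary, [f] would already bound inside Z'. *)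
Lemma tauB_quot q j : tauB Z' Z q j -> tau W q.+1 j.
Proof.
move=> [f [hf cf nf [g hg eg]]]; exists (fmap v g); split.
- exact: img.
- by rewrite /= tens_fmap eg (ker hf).
move=> [h hh eh]; have [h' hh' eh'] := lift hh.
apply: nf; exists (g - tens (@rphi _ K q.+1) h').
  apply: kerI.
    by apply: (pregradedB (chain_pregraded _ pZ)) => //; apply: tch.
  by rewrite raddfB /= -tens_fmap eh' eh subrr.
by rewrite raddfB /= eg tens_comp0 ?subr0//; apply: rphi_cx.
Qed.

Lemma tau_sub q j : tau Z' q j -> tau Z q j \/ tauB Z' Z q j.
Proof.
move=> [f [hf cf nf]]; have [b|nb] := pselect (bnd Z j f).
  by right; exists f.
by left; exists f; split=> //; apply: sub.
Qed.

End Ses.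

(** The entries of K_1 -> K_0 = A generate A_+, so T_0 is Z / A_+ Z. *)
Lemma bnd0 (M : lmodType A) (Z : int -> set M) j (f : fsfam (rX K 0) M) :
  pregraded Z -> bnd Z j f <-> irrh Z j (f (r0 K)).
Proof.
move=> pZ; split=> [[g hg <-]|].
  rewrite tensE_supp; apply: irrh_sum => x _.
  have [h1 h2] := rphi_J x; have [x0|x0] := ltP 0 (rdeg x).
    exact: irrhM x0 h1 (hg x).
  by rewrite h2// scale0r; apply: irrh0.
have -> : f = delta (r0 K) (f (r0 K)).
  by apply: fsfamP => x; rewrite deltaE (r0_unique x) eqxx.
rewrite deltaE eqxx; elim=> {f} [|x y _ [f hf ef] _ [g hg eg]|i a z i0 ha hz].
- exists 0; first exact: (pregraded0 (chain_pregraded _ pZ)).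
  by rewrite raddf0; apply: fsfamP => x; rewrite deltaE if_same.
- exists (f + g); first exact: (pregradedD (chain_pregraded _ pZ)).
  rewrite raddfD /= ef eg; apply: fsfamP => u.
  by rewrite fsD !deltaE; case: eqP => //; rewrite addr0.
have [|f hf ef] := @r_exact0 _ K i a.
  by split=> // i1; have := lt_le_trans i0 i1; rewrite ltxx.
exists (fmap (scalel z) f).
  by move=> x; rewrite fmapE; apply: (pregradedZ pZ (hf x) hz); ring.
rewrite tens_fmap; apply: fsfamP => x.
by rewrite fmapE deltaE (r0_unique x) eqxx ef.
Qed.

Lemma tau0 (M : lmodType A) (Z : int -> set M) j : pregraded Z ->
  tau Z 0 j <-> exists2 m, Z j m & ~ irrh Z j m.
Proof.
move=> pZ; split=> [[f [hf _ nf]]|[m Zm nm]].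
  exists (f (r0 K)); first by have := hf (r0 K); rewrite rdeg0 subr0.
  by rewrite -bnd0.
exists (delta (r0 K) m); split=> //.
  by apply: chain_delta => //; rewrite rdeg0 subr0.
by rewrite bnd0// deltaE eqxx.
Qed.

Lemma tauB0 (M : lmodType A) (Z' Z : int -> set M) j : pregraded Z' -> pregraded Z ->
  tauB Z' Z 0 j <-> exists m, [/\ Z' j m, ~ irrh Z' j m & irrh Z j m].
Proof.
move=> pZ' pZ; split=> [[f [hf _ nf bf]]|[m [Zm nm im]]].
  exists (f (r0 K)); split; first by have := hf (r0 K); rewrite rdeg0 subr0.
    by rewrite -bnd0.
  by rewrite -bnd0.
exists (delta (r0 K) m); split=> //; try by rewrite bnd0// deltaE eqxx.
by apply: chain_delta => //; rewrite rdeg0 subr0.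
Qed.

(* Covers free modules (W = A), projective modules (W = A, forgetting degrees),
   and free R-modules seen over S (W = R). *)
Definition dual_basis (D : set int) (N : lmodType A) (W : int -> set N)
    (M : lmodType A) (Z : int -> set M) : Prop :=
  forall s : seq M, exists n (io : 'I_n -> {linear N -> M})
    (co : 'I_n -> {linear M -> N}) (a : 'I_n -> int),
  [/\ forall i, D (a i), forall i j x, W j x -> Z (j + a i) (io i x),
      forall i j x, Z j x -> W (j - a i) (co i x)
    & forall m, m \in s -> m = \sum_i io i (co i m)].

(** If every coordinate of the cycle [f] bounded, the bounding chains could be reassembled into one
    for [f]; the dual basis has to serve only the finitely many values of [f]. *)
Lemma tau_dual_basis D (N : lmodType A) (W : int -> set N) (M : lmodType A)
    (Z : int -> set M) q j :
  pregraded Z -> dual_basis D W Z -> tau Z q j -> exists2 a, D a & tau W q (j - a).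
Proof.
move=> pZ db [f [hf cf nf]]; apply: contrapT => no; apply: nf.
have [n [io [co [a [Da hio hco e]]]]] := db [seq f x | x <- supp f].
have /choice[g hg] : forall i, exists g : fsfam (rX K q.+1) N,
    chain (@rdeg _ K q.+1) W (j - a i) g /\
    tens (@rphi _ K q) g = fmap (co i) f.
  move=> i; apply: contrapT => nb; apply: no.
  exists (a i) => //; exists (fmap (co i) f); split.
  - exact: (chain_fmap (hco i) hf).
  - exact: cyc_fmap.
  by move=> [g hg eg]; apply: nb; exists g.
exists (\sum_i fmap (io i) (g i)).
  apply: (pregraded_sum (chain_pregraded _ pZ)) => i _.
  have -> : j = j - a i + a i by ring.
  by have [h _] := hg i; exact: (chain_fmap (hio i) h).
rewrite raddf_sum; apply: fsfamP => x; rewrite fs_sum.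
have -> : f x = \sum_i io i (co i (f x)).
  have [xs|xs] := boolP (x \in supp f); first by apply: e; apply: map_f.
  by rewrite (suppP xs) big1// => i _; rewrite !raddf0.
by apply: eq_bigr => i _; rewrite /= tens_fmap; have [_ ->] := hg i.
Qed.

Lemma tau_regular q j : ~ tau (@gpart k A : int -> set A^o) q.+1 j.
Proof.
move=> [f [hf cf nf]]; apply: nf; have [g hg eg] := r_exact hf cf.
by exists g.
Qed.

End Tau.

End Pregraded.

(** * Direct sums of shifts as graded modules *)

Section ChainMod.
Variables (k : fieldType) (A : gradedAlg k).

Definition regMod : gradedMod A :=
  @GradedMod k A A^o (@gpart k A) (gpart_grading A) (@gpart_mul k A).

Variables (X : choiceType) (dg : X -> int) (N : gradedMod A).

Let comp_fin (f : fsfam X N) j : exists s : seq X, forall x, x \notin s ->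
  hcomp (mpart_grading N) (f x) (j - dg x) = 0.
Proof. by exists (supp f) => x /suppP ->; rewrite hcomp0. Qed.

Lemma chain_grading : is_grading (chain dg (@mpart k A N)).
Proof.
split=> [j|f|s f us hf e j js].
- split=> [x|x y]; first exact: (pregraded0 (mpart_pregraded N)).
  exact: (pregradedB (chain_pregraded _ (mpart_pregraded N))).
(* The degrees of the components of [f]: an entry at [x] is shifted by [dg x]. *)
- pose S := undup [seq dg x + n | x <- supp f,
                                  n <- hcomp_support (mpart_grading N) (f x)].
  exists S, (fun j => Fsfam (comp_fin f j)); split.
  + exact: undup_uniq.
  + by move=> j x; apply: hcomp_part.
  apply: fsfamP => x; rewrite fs_sum /=.
  rewrite -(big_map (fun j => j - dg x) xpredT
     (fun n => hcomp (mpart_grading N) (f x) n)).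
  have [xs|/suppP ->] := boolP (x \in supp f); last first.
    by rewrite big1// => n _; rewrite hcomp0.
  apply: hcomp_sum => [|n hn].
    by rewrite map_inj_uniq ?undup_uniq// => n1 n2 /addIr.
  apply/mapP; exists (dg x + n); last by rewrite addrC addKr.
  by rewrite mem_undup; apply/allpairsPdep; exists x, n.
apply: fsfamP => x.
have [_ _ h] := mpart_grading N.
have := h [seq j - dg x | j <- s] (fun n => f (n + dg x) x).
rewrite map_inj_uniq => [/(_ us)|n1 n2 /addIr//] h'.
have := h' _ _ (j - dg x); rewrite subrK; apply.
- by move=> n; have := hf (n + dg x) x; rewrite addrK.
- rewrite big_map -[RHS](fs0 N x) -e fs_sum.
  by apply: eq_bigr => n _; rewrite subrK.
by apply: map_f.
Qed.

Definition chainMod : gradedMod A :=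
  GradedMod chain_grading
    (let: And3 _ _ h := chain_pregraded dg (mpart_pregraded N) in h).

End ChainMod.

(** Homogeneous components commute with [tens phi], so an arbitrary kernel element is treated one
    component at a time. Both [is_resolution] and projective modules require exactness without
    degrees. *)
Lemma tens_ungraded_exact (k : fieldType) (A : gradedAlg k) (X Y Z : choiceType)
    (dX : X -> int) (dY : Y -> int) (dZ : Z -> int)
    (phi : X -> fsfam Y A^o) (psi : Z -> fsfam X A^o) :
  (forall x, chain dY (@gpart k A : int -> set A^o) (dX x) (phi x)) ->
  (forall j f, chain dX (@gpart k A : int -> set A^o) j f -> tens phi f = 0 ->
    exists2 g, chain dZ (@gpart k A : int -> set A^o) j g & tens psi g = f) ->
  forall f : fsfam X A^o, tens phi f = 0 -> exists g : fsfam Z A^o, tens psi g = f.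
Proof.
move=> hphi ex f f0.
pose MX := chainMod dX (regMod A); pose MY := chainMod dY (regMod A).
have gr j (y : MX) : mpart j y -> mpart (g := MY) j (tens phi y).
  exact: tens_chain (gpart_pregraded A) hphi.
have /choice[g hg] : forall j, exists g,
    tens psi g = hcomp (mpart_grading MX) f j.
  move=> j; have [||g _ <-] := ex j (hcomp (mpart_grading MX) f j).
  - exact: (hcomp_part (mpart_grading MX)).
  - have := @hcomp_map k A MX MY (tens phi) f j gr.
    by move=> <-; rewrite [X in hcomp _ X _](_ : _ = 0) ?hcomp0//; exact: f0.
  by exists g.
have [us _ _ e] := hcompP (mpart_grading MX) f.
exists (\sum_(j <- hcomp_support (mpart_grading MX) f) g j).
by rewrite raddf_sum [RHS]e; apply: eq_bigr => j _; apply: hg.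
Qed.

(** * Dual bases of free and projective modules *)

Section DualBases.
Variables (k : fieldType) (A : gradedAlg k).

Lemma dual_basis_family (X : choiceType) (B : set X) (dg : X -> int)
    (M N : lmodType A) (Z : int -> set M) (W : int -> set N)
    (io : X -> {linear N -> M}) (co : X -> {linear M -> N}) :
  (forall x j n, B x -> W j n -> Z (j + dg x) (io x n)) ->
  (forall x j m, B x -> Z j m -> W (j - dg x) (co x m)) ->
  (forall m, exists s, [/\ uniq s, forall x, x \in s -> B x,
      forall x, x \notin s -> co x m = 0 & m = \sum_(x <- s) io x (co x m)]) ->
  dual_basis [set dg x | x in B] W Z.
Proof.
move=> hio hco /choice[t ht] s.
(* The finitely many elements of [s] involve only finitely many indices of the family. *)
pose u := undup (flatten [seq t m | m <- s]).
have uB x : x \in u -> B x.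
  rewrite mem_undup => /flattenP[_ /mapP[m _ ->]].
  by have [_ h _ _] := ht m; apply: h.
have uT i : B (tnth (in_tuple u) i) by apply/uB/mem_tnth.
exists (size u), (fun i => io (tnth (in_tuple u) i)),
  (fun i => co (tnth (in_tuple u) i)), (fun i => dg (tnth (in_tuple u) i)).
split=> [i|i j x|i j x|m ms].
- by exists (tnth (in_tuple u) i).
- exact: hio.
- exact: hco.
rewrite -(big_tnth _ _ u xpredT (fun x => io x (co x m))).
have [us _ off {1}->] := ht m.
apply: sum_uniq_supp; rewrite ?undup_uniq// => x xs.
  by rewrite off ?raddf0.
rewrite off ?raddf0//; apply: contra xs => xs.
rewrite mem_undup; apply/flattenP; exists (t m) => //.
exact: map_f.
Qed.

Definition coord (X : choiceType) (M : lmodType A) (h : {linear M -> fsfam X A^o})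
  (x : X) (m : M) : A^o := h m x.
Lemma coord_linear (X : choiceType) (M : lmodType A)
    (h : {linear M -> fsfam X A^o}) x : linear (coord h x).
Proof. by move=> a u v; rewrite /coord linearP. Qed.
HB.instance Definition _ (X : choiceType) (M : lmodType A)
    (h : {linear M -> fsfam X A^o}) x :=
  GRing.isLinear.Build A M A^o _ (coord h x) (coord_linear h x).

(** A linear section [h] of the map from a free module onto M supplies the coordinates; [B] selects
    the indices that really occur. *)
Lemma dual_basis_lcomb (X : choiceType) (B : set X) (dg : X -> int)
    (M : lmodType A) (Z : int -> set M) (W : int -> set A^o) (phi : X -> M)
    (h : {linear M -> fsfam X A^o}) :
  (forall x j (a : A), B x -> W j a -> Z (j + dg x) (a *: phi x)) ->
  (forall x j m, B x -> Z j m -> W (j - dg x) (h m x)) ->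
  (forall m x, ~ B x -> h m x = 0) ->
  (forall m, lcomb phi (h m) = m) ->
  dual_basis [set dg x | x in B] W Z.
Proof.
move=> hio hco off e.
apply: (@dual_basis_family X B dg M A^o Z W
  (fun x => scalel (phi x)) (fun x => coord h x)) => // m.
exists [seq x <- supp (h m) | `[< B x >]].
have off' x : x \notin [seq x <- supp (h m) | `[< B x >]] -> h m x = 0.
  rewrite mem_filter negb_and => /orP[/asboolPn/off ->//|].
  by move/suppP.
split=> //; first by rewrite filter_uniq// supp_uniq.
- by move=> x; rewrite mem_filter => /andP[/asboolP].
by rewrite -{1}(e m); apply: lcombE off'; rewrite filter_uniq// supp_uniq.
Qed.

Lemma dual_basis_projective (P : lmodType A) : projective P ->
  dual_basis setT (fun=> [set: A^o]) (fun=> [set: P]).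
Proof.
move=> projP.
(* The identity of P is lifted through the free module on the underlying set of P. *)
have [|h hh] := projP (fsfam P A^o) P (lcomb id) idfun.
  by move=> y; exists (delta y (1 : A^o)); rewrite /= lcomb_delta scale1r.
have db : dual_basis [set 0 | _ in [set: P]] (fun=> [set: A^o]) (fun=> [set: P]).
  by apply: (@dual_basis_lcomb P setT (fun=> 0) P _ _ id h) => // m x; case.
move=> s; have [n [io [co [a [_ h1 h2 h3]]]]] := db s.
by exists n, io, co, a.
Qed.

Lemma hcomp_scaler (M : gradedMod A) i (a : A) (x : M) j : mpart i x ->
  hcomp (mpart_grading M) (a *: x) j = hcomp (gpart_grading A) a (j - i) *: x.
Proof.
move=> hx; have [us hc cs e] := hcompP (gpart_grading A) a.
pose s := hcomp_support (gpart_grading A) a.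
apply: (@hcomp_unique _ _ (mpart_grading M) _ [seq n + i | n <- s]
  (fun j => hcomp (gpart_grading A) a (j - i) *: x)).
- by rewrite map_inj_uniq // => n1 n2 /addIr.
- by move=> n /=; rewrite -{1}[n](subrK i); apply: mpart_scale.
- move=> n hn; rewrite cs ?scale0r//; apply: contra hn => hn.
  by apply/mapP; exists (n - i) => //; ring.
rewrite big_map {1}e scaler_suml; apply: eq_bigr => n _.
by congr (hcomp _ _ _ *: _); ring.
Qed.

Section FreeCoord.
Variables (F : gradedMod A) (B : set F).
Hypothesis Bspan : forall x : F, exists (s : seq F) (c : F -> A),
  (forall b, b \in s -> B b) /\ x = \sum_(b <- s) c b *: b.
Hypothesis Bfree : forall (s : seq F) (c : F -> A), uniq s ->
  (forall b, b \in s -> B b) -> \sum_(b <- s) c b *: b = 0 ->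
  forall b, b \in s -> c b = 0.

(** Coordinates are indexed by all of F and vanish off the basis, so that the basis needs no type of
    its own. *)
Let coords (f : fsfam F A^o) := forall b, ~ B b -> f b = 0.

Lemma free_coords x : exists f : fsfam F A^o, coords f /\ lcomb id f = x.
Proof.
have [s [c [sB ->]]] := Bspan x; exists (\sum_(b <- s) delta b (c b)).
split=> [b nb|].
  rewrite fs_sum big1_seq// => b' /andP[_ b's]; rewrite deltaE.
  by case: eqP => // e; case: nb; rewrite e; apply: sB.
by rewrite raddf_sum; apply: eq_bigr => b _; rewrite /= lcomb_delta.
Qed.

Lemma free_coords_inj f g : coords f -> coords g -> lcomb id f = lcomb id g -> f = g.
Proof.
move=> hf hg e; apply/eqP; rewrite -subr_eq0; apply/eqP; set h := f - g.
have hB b : ~ B b -> h b = 0 by move=> nb; rewrite fsB hf// hg// subrr.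
have h0 : lcomb id h = 0 by rewrite raddfB /= e subrr.
pose s := [seq x <- supp h | `[< B x >]].
have off b : b \notin s -> h b = 0.
  by rewrite mem_filter negb_and => /orP[/asboolPn/hB//|/suppP].
have us : uniq s by rewrite filter_uniq// supp_uniq.
apply: fsfamP => b; have [bs|/off//] := boolP (b \in s).
apply: (@Bfree s h us _ _ b bs) => [b'|]; first by rewrite mem_filter => /andP[/asboolP].
by have := lcombE id us off; rewrite h0 => /esym.
Qed.

Definition free_coord (x : F) : fsfam F A^o := sval (cid (free_coords x)).

Lemma free_coordP x : coords (free_coord x) /\ lcomb id (free_coord x) = x.
Proof. exact: (svalP (cid (free_coords x))). Qed.

Lemma free_coord_linear : linear free_coord.
Proof.
move=> a x y; have [h1 e1] := free_coordP x; have [h2 e2] := free_coordP y.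
have [h3 e3] := free_coordP (a *: x + y).
apply: free_coords_inj => // [b nb|]; last by rewrite e3 linearP /= e1 e2.
by rewrite fsD fsZ h1// h2// scaler0 addr0.
Qed.
HB.instance Definition _ :=
  GRing.isLinear.Build A F (fsfam F A^o) _ free_coord free_coord_linear.

(** Replacing each coordinate by its component of the expected degree yields another expansion of
    the homogeneous [x], and expansions are unique. *)
Lemma free_coord_part (dg : F -> int) : (forall b, B b -> mpart (dg b) b) ->
  forall j x b, mpart j x -> B b -> gpart (j - dg b) (free_coord x b).
Proof.
move=> hdg j x b hx Bb; have [h e] := free_coordP x.
have ffin : exists s : seq F, forall b, b \notin s ->
    hcomp (gpart_grading A) (free_coord x b) (j - dg b) = 0.
  by exists (supp (free_coord x)) => c /suppP ->; rewrite hcomp0.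
pose f : fsfam F A^o := Fsfam ffin.
suff <- : f = free_coord x by apply: hcomp_part.
apply: free_coords_inj => // [c nc|]; first by rewrite /= h// hcomp0.
rewrite e -(hcomp_id (mpart_grading F) hx) -{1}e {2}/lcomb /fsum hcomp_sumr.
rewrite (@lcombE _ _ _ id (supp (free_coord x))) ?supp_uniq//; last first.
  by move=> c /suppP h'; rewrite /= h' hcomp0.
apply: eq_bigr => c _ /=; rewrite /scalel.
have [Bc|nBc] := pselect (B c); first by rewrite (hcomp_scaler _ _ (hdg _ Bc)).
by rewrite h// !scale0r !hcomp0 scale0r.
Qed.

End FreeCoord.

Lemma dual_basis_free (F : gradedMod A) : graded_free F ->
  dual_basis setT (@gpart k A : int -> set A^o) (@mpart k A F).
Proof.
move=> [B [Bhom Bspan Bfree]].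
have /choice[dg hdg] : forall b, exists j, B b -> mpart j b.
  move=> b; have [/Bhom[j hj]|nb] := pselect (B b); first by exists j.
  by exists 0.
have db : dual_basis [set dg b | b in B] (@gpart k A : int -> set A^o)
    (@mpart k A F).
  apply: (@dual_basis_lcomb F B dg F _ _ id (free_coord Bspan)).
  - by move=> x j a Bx ha; apply: mpart_scale => //; apply: hdg.
  - by move=> x j m Bx hm; exact: (@free_coord_part F B Bspan Bfree dg hdg j m x hm Bx).
  - by move=> m x nx; have [h _] := free_coordP Bspan m; apply: h.
  - by move=> m; have [] := free_coordP Bspan m.
move=> s; have [n [io [co [a [_ h1 h2 h3]]]]] := db s.
by exists n, io, co, a.
Qed.

End DualBases.

(** * Balancing *)

Section Irrelevant.
Variables (k : fieldType) (A : gradedAlg k) (M : gradedMod A).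

Lemma irrelevant_mul0 : irrelevant_mul (0 : M).
Proof. by exists [::]; rewrite big_nil. Qed.

Lemma irrelevant_mulD (x y : M) :
  irrelevant_mul x -> irrelevant_mul y -> irrelevant_mul (x + y).
Proof.
move=> [s [hs ->]] [t [ht ->]]; exists (s ++ t); rewrite big_cat; split=> // p.
by rewrite mem_cat => /orP[/hs|/ht].
Qed.

Lemma irrelevant_mulM (a : A) (x : M) : irrelevant a -> irrelevant_mul (a *: x).
Proof.
move=> ha; exists [:: (a, x)]; rewrite big_seq1; split=> // p.
by rewrite inE => /eqP ->.
Qed.

Lemma irrh_irrelevant_mul j (x : M) : irrh (@mpart k A M) j x -> irrelevant_mul x.
Proof.
elim=> [|u v _ hu _ hv|i a z i0 ha hz]; first exact: irrelevant_mul0.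
  exact: irrelevant_mulD.
by apply: irrelevant_mulM; apply: irrelevant_hom ha.
Qed.

(** With [irrh_irrelevant_mul], this identifies the ungraded A_+ M with the graded one on
    homogeneous elements. *)
Lemma irrelevant_mul_irrh j (x : M) : irrelevant_mul x ->
  irrh (@mpart k A M) j (hcomp (mpart_grading M) x j).
Proof.
move=> [s [hs ->]]; rewrite hcomp_sumr big_seq; apply: irrh_sum => p /hs[t [ht ->]].
rewrite scaler_suml hcomp_sumr big_seq; apply: irrh_sum => q /ht[q0 hq].
by rewrite (hcomp_scale _ _ hq); apply: irrhM hq _ => //; apply: hcomp_part.
Qed.

End Irrelevant.

Section Resolved.
Variables (k : fieldType) (A : gradedAlg k).

(** A graded free resolution of a family instead of a module. This form passes to the syzygies
    [kerPart e], which remain inside F 0, and so allows dimension shifting by induction. *)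
Record resolves (M : lmodType A) (Z : int -> set M) (F : nat -> gradedMod A)
    (d : forall i, {linear F i.+1 -> F i}) (e : {linear F 0 -> M}) : Prop :=
  Resolves {
  res_free : forall i, graded_free (F i);
  res_part : forall i j x, mpart j x -> mpart j (d i x);
  res_exact : forall i y, d i y = 0 <-> exists z, d i.+1 z = y;
  res_part0 : forall j x, mpart j x -> Z j (e x);
  res_surj : forall j y, Z j y -> exists2 x, mpart j x & e x = y;
  res_exact0 : forall y, e y = 0 <-> exists z, d 0 z = y }.

Definition kerPart (F : gradedMod A) (M : lmodType A) (e : {linear F -> M}) j : set F :=
  [set x | mpart j x /\ e x = 0].

Lemma kerPart_pregraded (F : gradedMod A) (M : lmodType A) (e : {linear F -> M}) :
  pregraded (kerPart e).
Proof.
have pF := mpart_pregraded F.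
split=> [j|j x y [hx ex] [hy ey]|i j a x ha [hx ex]].
- by split; [apply: (pregraded0 pF)|rewrite raddf0].
- by split; [apply: (pregradedB pF)|rewrite raddfB /= ex ey subrr].
by split; [apply: mpart_scale|rewrite linearZ /= ex scaler0].
Qed.

Lemma graded_lift (M N : gradedMod A) (u : {linear M -> N}) j (x : M) (y : N) :
  (forall i z, mpart i z -> mpart i (u z)) -> mpart j y -> u x = y ->
  u (hcomp (mpart_grading M) x j) = y.
Proof. by move=> hu hy ux; rewrite -hcomp_map// ux hcomp_id. Qed.

Lemma graded_free_resolution_resolves (N : gradedMod A) (F : nat -> gradedMod A)
    (d : forall i, {linear F i.+1 -> F i}) (e : {linear F 0 -> N}) :
  graded_free_resolution d e -> resolves (@mpart k A N) d e.
Proof.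
move=> [[es e0 ed] fr dp ep]; split=> // j y hy; have [x ex] := es y.
exists (hcomp (mpart_grading (F 0)) x j); first exact: hcomp_part.
exact: graded_lift ex.
Qed.

Section Shift.
Variables (M : lmodType A) (Z : int -> set M) (F : nat -> gradedMod A).
Variables (d : forall i, {linear F i.+1 -> F i}) (e : {linear F 0 -> M}).
Hypothesis res : resolves Z d e.

Lemma resolves_shift :
  resolves (F := fun i => F i.+1) (kerPart e) (fun i => d i.+1) (d 0).
Proof.
case: res => fr dp ed ep es e0; split=> //.
- by move=> i; apply: dp.
- by move=> j x hx; split; [apply: dp|apply/e0; exists x].
move=> j y [hy /e0[x dx]].
exists (hcomp (mpart_grading (F 1)) x j); first exact: hcomp_part.
by apply: graded_lift dx => //; apply: dp.
Qed.

Lemma resolves_ses : ses (kerPart e) (@mpart k A (F 0)) Z e.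
Proof.
by split; [apply: mpart_pregraded | | apply: res_part0 res | apply: res_surj res].
Qed.

Lemma irrh_lift j y : irrh Z j y ->
  exists2 x, irrh (@mpart k A (F 0)) j x & e x = y.
Proof.
elim=> [|y1 y2 _ [x1 h1 e1] _ [x2 h2 e2]|i a z i0 ha hz].
- by exists 0; [apply: irrh0|rewrite raddf0].
- by exists (x1 + x2); [apply: irrhD|rewrite raddfD /= e1 e2].
have [x hx ex] := res_surj res hz.
by exists (a *: x); [apply: irrhM hx|rewrite linearZ /= ex].
Qed.

Lemma irrh_img j x : irrh (@mpart k A (F 0)) j x -> irrh Z j (e x).
Proof.
elim=> [|y1 y2 _ h1 _ h2|i a z i0 ha hz].
- by rewrite raddf0; apply: irrh0.
- by rewrite raddfD; apply: irrhD.
by rewrite linearZ /=; apply: irrhM ha _ => //; apply: res_part0 res _ _ _.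
Qed.

(** F_0 / (A_+ F_0 + im d) is Z / A_+ Z; since [x] is homogeneous, the ungraded relation on the left
    may be replaced by its component of degree [j]. *)
Lemma resolves_boundary j (x : F 0) : mpart j x ->
  tensor_boundary d x <-> irrh Z j (e x).
Proof.
move=> hx; split=> [[y hy]|/irrh_lift[u hu eu]].
  have := irrh_img (irrelevant_mul_irrh j hy).
  rewrite hcompB raddfB /= (hcomp_id _ hx) (hcomp_map _ _ (@res_part _ _ _ _ _ res 0)).
  have -> : e (d 0 (hcomp (mpart_grading (F 1)) y j)) = 0.
    by apply/(res_exact0 res); eexists.
  by rewrite subr0.
have /(res_exact0 res)[y ey] : e (x - u) = 0 by rewrite raddfB /= eu subrr.
by exists y; rewrite ey subKr; apply: irrh_irrelevant_mul hu.
Qed.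

End Shift.

Section Balance.
Variable (K : minRes (@posPart k A)).

Lemma tau_free (F : gradedMod A) q j : graded_free F -> ~ tau K (@mpart k A F) q.+1 j.
Proof.
move=> /dual_basis_free db /(tau_dual_basis (mpart_pregraded F) db)[a _].
exact: tau_regular.
Qed.

Section Connect.
Variables (M : lmodType A) (Z : int -> set M) (F : nat -> gradedMod A).
Variables (d : forall i, {linear F i.+1 -> F i}) (e : {linear F 0 -> M}).
Hypothesis res : resolves Z d e.

(** As T_(q+1)(F 0) = 0, the connecting homomorphism is injective, with image the kernel of T_q of
    the syzygies -> T_q(F 0). *)
Lemma tau_resolves q j :
  tau K Z q.+1 j <-> tauB K (kerPart e) (@mpart k A (F 0)) q j.
Proof.
split=> [|h]; last exact: (tauB_quot (resolves_ses res) h).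
move=> /(tau_quotS (resolves_ses res))[h|//].
by have := tau_free (res_free res 0) h.
Qed.

Lemma tau_resolvesS q j : tau K Z q.+2 j <-> tau K (kerPart e) q.+1 j.
Proof.
rewrite tau_resolves; split=> [[f [h1 h2 h3 _]]|]; first by exists f.
move=> /(tau_sub (resolves_ses res))[h|//].
by have := tau_free (res_free res 0) h.
Qed.

End Connect.

(** This frees [Tor_neq0] from the choice of a resolution. The shift is an isomorphism only from
    homological degree 2 on; degree 1 is the kernel of T_0 of the syzygies -> T_0(F 0) and is
    compared by hand. *)
Lemma tau_balanced i : forall (M : lmodType A) (Z : int -> set M)
    (F : nat -> gradedMod A) (d : forall i, {linear F i.+1 -> F i})
    (e : {linear F 0 -> M}) j,
  pregraded Z -> resolves Z d e ->
  tau K Z i j <->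
  exists x : F i, [/\ mpart j x, tensor_cycle d x & ~ tensor_boundary d x].
Proof.
elim: i => [|[|i] IH] M Z F d e j pZ res.
- rewrite tau0//; split=> [[m Zm nm]|[x [hx _ nx]]].
    have [x hx ex] := res_surj res Zm.
    by exists x; split=> //; rewrite (resolves_boundary res hx) ex.
  exists (e x); first exact: res_part0 res _ _ hx.
  by rewrite -(resolves_boundary res hx).
- have pK := kerPart_pregraded e; have pF := mpart_pregraded (F 0).
  have res' := resolves_shift res.
  rewrite (tau_resolves res) tauB0//; split=> [[m [Zm nm im]]|[x [hx cx nx]]].
    have [x hx ex] := res_surj res' Zm.
    exists x; split=> //=; first by rewrite ex; apply: irrh_irrelevant_mul im.
    by move=> h; apply: nm; rewrite -ex; apply/(resolves_boundary res' hx).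
  exists (d 0 x); split; first exact: res_part0 res' _ _ hx.
    by move=> /(resolves_boundary res' hx).
  have := irrelevant_mul_irrh j cx; rewrite hcomp_id//.
  exact: (res_part res).
rewrite (tau_resolvesS res).
exact: IH (kerPart_pregraded e) (resolves_shift res).
Qed.

(* By dimension shifting: S_+ visibly annihilates Tor_0. *)
Lemma tau_annihilated q : forall (M : lmodType A) (Z : int -> set M)
    (F : nat -> gradedMod A) (d : forall i, {linear F i.+1 -> F i})
    (e : {linear F 0 -> M}) i j (s : A) (f : fsfam (rX K q) M),
  pregraded Z -> resolves Z d e -> 0 < i -> gpart i s ->
  chain (@rdeg _ _ _ K q) Z j f -> cyc f -> bnd Z (i + j) (s *: f).
Proof.
elim: q => [|q IH] M Z F d e i j s f pZ res i0 hs hf cf.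
  apply/bnd0 => //; rewrite fsZ; apply: irrhM i0 hs _.
  by have := hf (r0 K); rewrite rdeg0 subr0 [i + j]addrC addrK.
have [pF hker hsub hlift] := resolves_ses res.
have [w hw ew] := chain_lift pF hlift hf.
have dw : chain (@rdeg _ _ _ K q) (kerPart e) j (tens (@rphi _ _ _ K q) w).
  have h : chain (@rdeg _ _ _ K q) (@mpart k A (F 0)) j (tens (@rphi _ _ _ K q) w).
    by apply: tens_chain hw => // x; apply: rphi_part.
  move=> x; split; first exact: h.
  by rewrite -fmapE -tens_fmap ew cf.
(* By induction [s] times the image of [f] under the connecting map is the boundary of some [u] in
   the syzygies. Then [s *: w - u] is a cycle over the free module F 0, hence a boundary, and [e]
   kills [u]. *)
have [u hu eu] := IH _ _ _ _ _ _ _ _ _ (kerPart_pregraded e)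
  (resolves_shift res) i0 hs dw (cyc_tens w).
have pC := chain_pregraded (@rdeg _ _ _ K q.+1) pF.
have hsw : chain (@rdeg _ _ _ K q.+1) (@mpart k A (F 0)) (i + j) (s *: w - u).
  apply: (pregradedB pC); last by move=> x; have [] := hu x.
  by have [_ _ h] := pC; apply: h.
have [[v hv ev]|nb] := pselect (bnd (@mpart k A (F 0)) (i + j) (s *: w - u)); last first.
  case: (@tau_free (F 0) q (i + j) (res_free res 0)); exists (s *: w - u).
  by split=> //=; rewrite linearB linearZ /= eu subrr.
exists (fmap e v); first by move=> x; apply: hsub.
rewrite tens_fmap ev linearB linearZ /= ew.
suff -> : fmap e u = 0 by rewrite subr0.
by apply: fsfamP => x; rewrite fmapE; have [_ ->] := hu x.
Qed.

(** If a homogeneous cycle bounds at all, the component of degree [j] of a bounding chain bounds it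
    too. *)
Lemma tau_forget_grading (N : gradedMod A) q j :
  tau K (@mpart k A N) q j -> tau K (fun=> [set: N]) q j.
Proof.
move=> [f [hf cf nf]]; exists f; split=> // -[g _ eg]; apply: nf.
pose MX := chainMod (@rdeg _ _ _ K q.+1) N; pose MY := chainMod (@rdeg _ _ _ K q) N.
exists (hcomp (mpart_grading MX) (g : MX) j); first exact: (hcomp_part (mpart_grading MX)).
apply: (@graded_lift MX MY (tens (@rphi _ _ _ K q)) j g f) => // i z hz.
exact: tens_chain (mpart_pregraded N) (@rphi_part _ _ _ K q) hz.
Qed.

Lemma tau_projective (P : lmodType A) q j : projective P ->
  ~ tau K (fun=> [set: P]) q.+1 j.
Proof.
move=> /dual_basis_projective db /(tau_dual_basis (@setT_pregraded _ _ P) db)[a _].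
move=> [f [_ cf nf]]; apply: nf.
have [g eg] : exists g : fsfam _ A^o, tens (@rphi _ _ _ K q.+1) g = f.
  apply: (@tens_ungraded_exact k A _ _ _ (@rdeg _ _ _ K q.+1) (@rdeg _ _ _ K q)
    (@rdeg _ _ _ K q.+2)) cf; last exact: r_exact.
  exact: rphi_part.
by exists g.
Qed.

(** Dimension shifting down to the zero module P q. The family [range e] stands for the resolved
    module, so that the induction passes to [range (d 0)] as it is. *)
Lemma tau_projective_resolution q : forall (N : lmodType A) (P : nat -> lmodType A)
    (d : forall i, {linear P i.+1 -> P i}) (e : {linear P 0 -> N}) j,
  (forall y, e y = 0 <-> exists z, d 0 z = y) ->
  (forall i y, d i y = 0 <-> exists z, d i.+1 z = y) ->
  (forall i, projective (P i)) -> (forall x : P q, x = 0) ->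
  ~ tau K (fun=> range e) q j.
Proof.
elim: q => [|q IH] N P d e j e0 ed pP Pq.
  move=> [f [hf _ nf]]; apply: nf; exists 0.
    by move=> x; exists 0 => //; rewrite raddf0.
  rewrite raddf0; apply: fsfamP => x; have [y _ <-] := hf x.
  by rewrite (Pq y) raddf0.
have sesP : ses (fun=> range (d 0)) (fun=> [set: P 0]) (fun=> range e) e.
  split=> // _ x; split=> [[y _ <-]|[_ /e0[y <-]]]; last by exists y.
  by split=> //; apply/e0; exists y.
move=> /(tau_quotS sesP)[|[f [h1 h2 h3 _]]]; first exact: tau_projective.
by apply: (IH _ _ (fun i => d i.+1) (d 0) j) => //; exists f.
Qed.

End Balance.

End Resolved.

(** * Minimal resolutions *)

Lemma total_bigcup_seq (T : eqType) (F : set (set T)) (s : seq T) :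
  total_on F subset -> F !=set0 ->
  (forall b, b \in s -> (\bigcup_(X in F) X) b) ->
  exists2 X, F X & forall b, b \in s -> X b.
Proof.
move=> tot [X0 FX0]; elim: s => [|b s IH] hs; first by exists X0.
have [|X FX sX] := IH; first by move=> c cs; apply: hs; rewrite inE cs orbT.
have [Y FY Yb] := hs b (mem_head _ _).
have [XY|YX] := tot _ _ FX FY.
  by exists Y => // c; rewrite inE => /orP[/eqP ->//|/sX/XY].
by exists X => // c; rewrite inE => /orP[/eqP ->|/sX//]; apply: YX.
Qed.

(** * Minimal generators and the graded Nakayama lemma *)

Section Cover.
Variables (k : fieldType) (A : gradedAlg k) (M : lmodType A) (Z : int -> set M).
Hypothesis Z_uniq : forall i j z, Z i z -> Z j z -> i != j -> z = 0.
Hypothesis Z_neg : forall j z, j < 0 -> Z j z -> z = 0.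

Let gpart_scalar (c : k) : gpart 0 (c%:A : A).
Proof. by apply/gpart0; exists c. Qed.

Lemma irrh_scalar j (c : k) (x : M) : irrh Z j x -> irrh Z j ((c%:A : A) *: x).
Proof.
elim=> [|y z _ hy _ hz|i a z i0 ha hz].
- by rewrite scaler0; apply: irrh0.
- by rewrite scalerDr; apply: irrhD.
rewrite scalerA; apply: irrhM i0 _ hz.
by rewrite -[i]add0r; apply: gpart_mul.
Qed.

Lemma irrhN j (x : M) : irrh Z j x -> irrh Z j (- x).
Proof. by move=> /(irrh_scalar (-1)); rewrite scaleNr !scale1r scaleN1r. Qed.

(* By the graded Nakayama lemma, a maximal such B is a minimal system of
   generators of Z. *)
Definition minimal_indep (B : set M) : Prop :=
  (forall b, B b -> exists j, Z j b) /\
  forall j (s : seq M) (c : M -> k), uniq s -> (forall b, b \in s -> B b /\ Z j b) ->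
    irrh Z j (\sum_(b <- s) ((c b)%:A : A) *: b) -> forall b, b \in s -> c b = 0.

Lemma minimal_indep_max : exists B, minimal_indep B /\
  forall C, B `<` C -> ~ minimal_indep C.
Proof.
apply: Zorn_bigcup => F FP tot; split=> [b [X FX Xb]|j s c us hs irr].
  by have [h _] := FP _ FX; apply: h.
(* The chain [F] may be empty, but then so is the list, and there is nothing to show. *)
case: s us hs irr => [//|b s] us hs irr.
have [||X FX sX] := @total_bigcup_seq _ F (b :: s) tot.
- by have [[X FX _] _] := hs b (mem_head _ _); exists X.
- by move=> x /hs[].
have [_ h] := FP _ FX; apply: (h j _ _ us) irr => x xs.
by split; [apply: sX|have [] := hs x xs].
Qed.

Section Maximal.
Variable B : set M.
Hypotheses (indB : minimal_indep B) (maxB : forall C, B `<` C -> ~ minimal_indep C).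

Lemma minimal_indep_neq0 b : B b -> b != 0.
Proof.
move=> Bb; apply/eqP => b0; have [hom ind] := indB; have [j hj] := hom _ Bb.
have := ind j [:: b] (fun=> 1) isT; rewrite big_seq1 b0 scaler0.
move=> /(_ _ (irrh0 Z j) 0 (mem_head _ _)) h.
suff /eqP : 1 = 0 :> k by rewrite oner_eq0.
by apply: h => x; rewrite inE => /eqP ->; rewrite -b0.
Qed.

(** By maximality, adding [z] to [B] creates a relation; its coefficient at [z] is nonzero since [B]
    is independent, and dividing by it expresses [z]. *)
Lemma minimal_indep_span j z : Z j z -> exists (s : seq M) (c : M -> k) w,
  [/\ uniq s, forall b, b \in s -> B b /\ Z j b, irrh Z j w
    & z = \sum_(b <- s) ((c b)%:A : A) *: b + w].
Proof.
move=> Zz; apply: contrapT => no; have [hom ind] := indB.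
have zB : ~ B z.
  move=> Bz; apply: no; exists [:: z], (fun=> 1), 0.
  split=> //; [|exact: irrh0|by rewrite big_seq1 addr0 !scale1r].
  by move=> b; rewrite inE => /eqP ->.
have z0 : z != 0.
  apply/eqP => z0; apply: no; exists [::], (fun=> 0), 0.
  by split=> //; [exact: irrh0|rewrite big_nil addr0].
apply: (maxB (C := B `|` [set z])).
  by split=> [b Bb|h]; [left|apply: zB; apply: h; right].
split=> [b [/hom//|->]|i s c us hs irr]; first by exists j.
have [zs|zs] := boolP (z \in s); last first.
  apply: (ind i s c us) irr => b bs; have [[Bb|bz] Zb] := hs b bs => //.
  by rewrite -bz bs in zs.
have eij : i = j.
  apply/eqP/negPn/negP => ij; have [_ Ziz] := hs z zs.
  by rewrite (Z_uniq Ziz Zz ij) eqxx in z0.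
rewrite eij in hs irr.
have us' : uniq (rem z s) by apply: rem_uniq.
have hs' b : b \in rem z s -> B b /\ Z j b.
  rewrite mem_rem_uniq// inE => /andP[bz /hs[[//|e] Zb]].
  by rewrite e eqxx in bz.
move: irr; rewrite (perm_big _ (perm_to_rem zs)) big_cons /= => irr.
have cz0 : c z = 0.
  apply/eqP/negPn/negP => cz; apply: no.
  exists (rem z s), (fun b => - ((c z)^-1 * c b)),
    ((((c z)^-1)%:A : A) *: ((c z)%:A *: z + \sum_(b <- rem z s) ((c b)%:A : A) *: b)).
  split=> //; first exact: irrh_scalar.
  rewrite scalerDr scalerA addrCA -[LHS]addr0; congr (_ + _).
    by rewrite -scalerAl mul1r scalerA mulVf// !scale1r.
  rewrite scaler_sumr -big_split big1//= => b _.
  rewrite scalerA -scalerDl -scalerAl mul1r scalerA -scalerDl addNr.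
  by rewrite !scale0r.
move: irr; rewrite cz0 !scale0r add0r => irr b bs.
have [->//|bz] := eqVneq b z.
by apply: (ind j _ _ us' hs' irr); rewrite mem_rem_uniq// inE bz.
Qed.

Definition bdeg (b : set_type B) : int :=
  sval (cid (proj1 indB (val b) (set_mem (valP b)))).

Lemma bdegP b : Z (bdeg b) (val b).
Proof. exact: (svalP (cid (proj1 indB (val b) (set_mem (valP b))))). Qed.

Lemma bdeg_unique b j : Z j (val b) -> bdeg b = j.
Proof.
move=> Zb; apply/eqP/negPn/negP => ne.
have := minimal_indep_neq0 (set_mem (valP b)).
by rewrite (Z_uniq (bdegP b) Zb ne) eqxx.
Qed.

Lemma bdeg_ge0 b : 0 <= bdeg b.
Proof.
rewrite leNgt; apply/negP => neg.
have := minimal_indep_neq0 (set_mem (valP b)).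
by rewrite (Z_neg neg (bdegP b)) eqxx.
Qed.

Let C := chain bdeg (@gpart k A : int -> set A^o).
Let phi (b : set_type B) : M := val b.
Let pC : pregraded C.
Proof. exact: chain_pregraded (gpart_pregraded A). Qed.

(** Modulo A_+ Z the elements of [B] span, and the remainder has coefficients of positive degree on
    elements of smaller degree. Induction on the degree ends because negative degrees vanish. *)
Lemma cover_surj j z : Z j z -> exists2 f, C j f & lcomb phi f = z.
Proof.
have [n] : exists n : nat, j < n%:Z by exists (`|j|.+1)%N; lia.
elim: n j z => [|n IH] j z jn Zz.
  by exists 0; [apply: (pregraded0 pC)|rewrite raddf0 (Z_neg jn Zz)].
have [s [c [w [us hs irr ->]]]] := minimal_indep_span Zz.
have [f Cf <-] : exists2 f, C j f & lcomb phi f = \sum_(b <- s) ((c b)%:A : A) *: b.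
  elim: s {us} hs => [|b s IHs] hs.
    by exists 0; [apply: (pregraded0 pC)|rewrite raddf0 big_nil].
  have [|f Cf ef] := IHs; first by move=> x xs; apply: hs; rewrite inE xs orbT.
  have [Bb Zb] := hs b (mem_head _ _).
  pose x : set_type B := exist _ b (mem_set Bb).
  exists (delta x ((c b)%:A : A^o) + f).
    apply: (pregradedD pC) => //; apply: chain_delta; first exact: gpart_pregraded.
    by rewrite (@bdeg_unique x j Zb) subrr.
  by rewrite raddfD /= lcomb_delta ef big_cons.
have [g Cg <-] : exists2 g, C j g & lcomb phi g = w.
  elim: irr => [|x y _ [g Cg <-] _ [h Ch <-]|i a y i0 ha hy].
  - by exists 0; [apply: (pregraded0 pC)|rewrite raddf0].
  - by exists (g + h); [apply: (pregradedD pC)|rewrite raddfD].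
  have [|g Cg <-] := IH (j - i) y _ hy; first by lia.
  exists (a *: g); last by rewrite linearZ.
  by apply: (pregradedZ pC ha Cg); ring.
by exists (f + g); [apply: (pregradedD pC)|rewrite raddfD].
Qed.

(** In a relation of degree [j], generators of smaller degree have coefficients in A_+ and those of
    larger degree have coefficient zero. So the part with scalar coefficients lies in A_+ Z, and
    independence applies. *)
Lemma cover_min j f : C j f -> lcomb phi f = 0 -> forall x, bdeg x = j -> f x = 0.
Proof.
move=> Cf f0 x xj.
(* The scalar coefficients are recorded as a function on M, as [minimal_indep] expects. *)
have /choice[c hc] : forall b : M, exists c : k,
    forall y : set_type B, val y = b -> bdeg y = j -> f y = c%:A.
  move=> b; have [[y [yb yj]]|no] := pselect (exists y, val y = b /\ bdeg y = j).
    have [c ec] : exists c : k, f y = c%:A.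
      by apply/gpart0; have := Cf y; rewrite yj subrr.
    exists c => y' y'b _; rewrite -ec; congr (f _).
    by apply: val_inj; rewrite yb.
  by exists 0 => y yb yj; case: no; exists y.
have [xs|/suppP//] := boolP (x \in supp f).
pose s := [seq phi y | y <- [seq y <- supp f | bdeg y == j]].
have us : uniq s.
  rewrite map_inj_uniq ?filter_uniq ?supp_uniq//; exact: val_inj.
have [_ /(_ j s c us) ind] := indB.
have -> : f x = (c (val x))%:A by apply: hc.
rewrite ind ?scale0r//; last first.
- by rewrite map_f// mem_filter xj eqxx.
- move: f0; rewrite /lcomb /fsum (bigID (fun y => bdeg y == j)) /= => f0.
  rewrite big_map big_filter.
  have -> : \sum_(i <- supp f | bdeg i == j) ((c (phi i))%:A : A) *: phi i
      = - \sum_(i <- supp f | bdeg i != j) scalel (phi i) (f i).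
    move/eqP: f0; rewrite addr_eq0 => /eqP <-.
    by apply: eq_bigr => y /eqP yj; rewrite /scalel (hc (phi y) y).
  apply/irrhN/irrh_sum => y yj; rewrite /scalel.
  have [lt|ge] := ltP (bdeg y) j.
    apply: (irrhM (i := j - bdeg y)); first by rewrite subr_gt0.
      exact: Cf.
    by rewrite subKr; apply: bdegP.
  rewrite (gpart_neg _ (Cf y)) ?scale0r; first exact: irrh0.
  by rewrite subr_lt0 lt_neqAle eq_sym yj.
move=> b /mapP[y]; rewrite mem_filter => /andP[/eqP yj _] ->.
by split; [apply/set_mem/valP|rewrite -yj; apply: bdegP].
Qed.

End Maximal.

End Cover.

(** * Iterated minimal covers *)

Section Resolution.
Variables (k : fieldType) (A : gradedAlg k).

(** The state of the iteration: the syzygies still to be covered, inside a free module. Generators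
    of nonnegative degree make the syzygies vanish in negative degrees, as [cover_surj] demands. *)
Record stage := Stage {
  sX : choiceType;
  sdeg : sX -> int;
  sdeg_ge0 : forall x, 0 <= sdeg x;
  sZ : int -> set (fsfam sX A^o);
  sZ_pregraded : pregraded sZ;
  sZ_sub : forall j z, sZ j z -> chain sdeg (@gpart k A : int -> set A^o) j z }.

Record cover (s : stage) := Cover {
  cvX : choiceType;
  cvdeg : cvX -> int;
  cvdeg_ge0 : forall x, 0 <= cvdeg x;
  cvphi : cvX -> fsfam (sX s) A^o;
  cvZ : forall x, sZ (cvdeg x) (cvphi x);
  cv_surj : forall j z, sZ j z ->
    exists2 f, chain cvdeg (@gpart k A : int -> set A^o) j f & tens cvphi f = z;
  cv_min : forall j f, chain cvdeg (@gpart k A : int -> set A^o) j f ->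
    tens cvphi f = 0 -> forall x, cvdeg x = j -> f x = 0 }.

Lemma cover_exists (s : stage) : exists _ : cover s, True.
Proof.
have Z_uniq i j z : @sZ s i z -> @sZ s j z -> i != j -> z = 0.
  move=> /sZ_sub hi /sZ_sub hj ij; apply: fsfamP => x.
  apply: (part_uniq (gpart_grading A) (hi x) (hj x)).
  by apply: contra ij => /eqP/addIr ->.
have Z_neg j z : j < 0 -> @sZ s j z -> z = 0.
  move=> j0 /sZ_sub hz; apply: fsfamP => x; apply: gpart_neg (hz x).
  by have := sdeg_ge0 x; lia.
have [B [indB maxB]] := minimal_indep_max (@sZ s).
unshelve eexists; last by [].
apply: (@Cover s _ (bdeg indB) _ val).
- exact: bdeg_ge0.
- by move=> x; apply: bdegP.
- move=> j z /(cover_surj Z_uniq Z_neg indB maxB)[f Cf ef].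
  by exists f; rewrite // tens_lcomb.
move=> j f Cf; rewrite tens_lcomb => f0 x.
exact: (cover_min Cf f0).
Qed.

Definition the_cover s : cover s := sval (cid (cover_exists s)).

Definition syz s (j : int) : set (fsfam (cvX (the_cover s)) A^o) :=
  [set f | chain (@cvdeg _ (the_cover s)) (@gpart k A : int -> set A^o) j f /\
           tens (@cvphi _ (the_cover s)) f = 0].

Lemma syz_pregraded s : pregraded (@syz s).
Proof.
have pC := chain_pregraded (@cvdeg _ (the_cover s)) (gpart_pregraded A).
split=> [j|j f g [hf f0] [hg g0]|i j a f ha [hf f0]].
- by split; [apply: (pregraded0 pC)|rewrite raddf0].
- by split; [apply: (pregradedB pC)|rewrite raddfB /= f0 g0 subrr].
by split; [apply: (pregradedZ pC ha hf)|rewrite linearZ /= f0 scaler0].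
Qed.

Definition next_stage (s : stage) : stage :=
  @Stage _ _ (@cvdeg_ge0 _ (the_cover s)) _ (@syz_pregraded s)
    (fun j z h => proj1 h).

Lemma minRes_exists (J : int -> set A) : pregraded (J : int -> set A^o) ->
  (forall j a, J j a -> gpart j a) -> (forall a, J 0 a -> a = 0) ->
  exists _ : minRes J, True.
Proof.
move=> pJ Jg J0.
pose Z j : set (fsfam unit A^o) := [set f | J j (f tt)].
have pZ : pregraded Z.
  split=> [j|j f g|i j a f].
  - exact: (pregraded0 pJ).
  - exact: (pregradedB pJ).
  by have [_ _ h] := pJ => ha hf; apply: h.
have sub j z : Z j z -> chain (fun=> 0) (@gpart k A : int -> set A^o) j z.
  by move=> h [] /=; rewrite subr0; apply: Jg.
pose s0 := @Stage unit (fun=> 0) (fun=> lexx 0) Z pZ sub.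
pose st n := iter n next_stage s0.
unshelve eexists; last by [].
apply: (@MinRes k A J (fun q => sX (st q)) (fun q => @sdeg (st q))
  (fun q => @cvphi _ (the_cover (st q))) tt) => //.
- by case.
- by move=> q x; apply: sZ_sub; apply: (@cvZ _ (the_cover (st q))).
(* Entries of the first matrix lie in J, which has no elements of degree 0. Later rows are
   relations, and [cv_min] kills their coefficients at generators of the same degree. *)
- case=> [|q] x y e.
    have := @cvZ _ (the_cover (st 0)) x.
    have -> : cvdeg x = 0 by exact: e.
    by case: y e => e; apply: J0.
  have [h1 h2] := @cvZ _ (the_cover (st q.+1)) x.
  by apply: (cv_min h1 h2); apply/esym.
- by move=> x; apply: (@cvZ _ (the_cover (st 0)) x).
- move=> j a Ja; have [|f Cf ef] := @cv_surj _ (the_cover (st 0)) j (delta tt (a : A^o)).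
    by [].
  by exists f => //; rewrite ef deltaE.
- by move=> q x; have [_ h2] := @cvZ _ (the_cover (st q.+1)) x.
move=> q j f hf f0.
by apply: (@cv_surj _ (the_cover (st q.+1)) j f).
Qed.


End Resolution.

Section MinResolution.
Variables (k : fieldType) (A : gradedAlg k) (J : int -> set A) (K : minRes J).

Definition freeMod (q : nat) : gradedMod A := chainMod (@rdeg _ _ _ K q) (regMod A).
Definition freeDiff (q : nat) : {linear freeMod q.+1 -> freeMod q} :=
  tens (@rphi _ _ _ K q).

Lemma one_part : gpart 0 (1 : A).
Proof. by apply/gpart0; exists 1; rewrite scale1r. Qed.

Lemma gpart_irrelevant j (a : A) : gpart j a -> (j <= 0 -> a = 0) -> irrelevant a.
Proof.
move=> ha a0; have [j0|j0] := ltP 0 j; first exact: irrelevant_hom ha.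
by rewrite a0//; apply: irrelevant0.
Qed.

Lemma rphi_irrelevant q (x : rX K q.+1) (y : rX K q) : irrelevant (rphi x y : A).
Proof.
apply: gpart_irrelevant (rphi_part x y) _ => le.
have [e|ne] := eqVneq (rdeg x) (rdeg y); first exact: rphi_min.
by apply: gpart_neg (rphi_part x y); rewrite lt_neqAle le subr_eq0 ne.
Qed.

Lemma tens_irrelevant q (g : fsfam (rX K q.+1) A^o) (y : rX K q) :
  irrelevant (tens (@rphi _ _ _ K q) g y : A).
Proof.
rewrite tensE_supp; apply: irrelevant_sum => x _.
by apply: irrelevantM; apply: rphi_irrelevant.
Qed.

Lemma irrelevant_mul_coord q (f : freeMod q) x :
  irrelevant_mul f -> irrelevant ((f : fsfam _ A^o) x : A).
Proof.
move=> [s [hs ->]]; rewrite fs_sum; apply: irrelevant_sum => p ps.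
by apply: irrelevantM; apply: hs.
Qed.

Lemma graded_free_freeMod q : graded_free (freeMod q).
Proof.
have inj (x y : rX K q) : delta x (1 : A^o) = delta y (1 : A^o) -> x = y.
  move=> /(congr1 (fun f : fsfam _ _ => f x)); rewrite !deltaE eqxx.
  by case: eqP => // _ /eqP; rewrite oner_eq0.
have dE (x : rX K q) (a : A^o) : delta x a = (a : A) *: delta x (1 : A^o).
  apply: fsfamP => y; rewrite fsZ !deltaE; case: eqP => _; last by rewrite scaler0.
  by rewrite /GRing.scale /= mulr1.
exists [set b : freeMod q | exists x, b = delta x (1 : A^o)]; split.
- move=> _ [x ->]; exists (rdeg x); apply: chain_delta; first exact: gpart_pregraded.
  by rewrite subrr; apply: one_part.
- move=> f; exists [seq delta x (1 : A^o) | x <- supp f].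
  have /choice[c hc] : forall b : freeMod q, exists a : A,
      forall x, b = delta x (1 : A^o) -> a = f x.
    move=> b; have [[x xb]|no] := pselect (exists x, b = delta x (1 : A^o)).
      by exists (f x) => y; rewrite xb => /inj ->.
    by exists 0 => x xb; case: no; exists x.
  exists c; split; first by move=> _ /mapP[x _ ->]; exists x.
  rewrite big_map {1}(fs_delta f); apply: eq_bigr => x _.
  by rewrite (hc _ x erefl) -dE.
move=> s c us hs e b bs; have [x xb] := hs b bs.
have := congr1 (fun f : fsfam _ _ => f x) e; rewrite fs_sum (bigD1_seq b)//= big1_seq.
  by rewrite addr0 ?fsZ xb deltaE eqxx /GRing.scale /= mulr1.
move=> b' /andP[nb b's]; have [y yb] := hs b' b's.
rewrite ?fsZ yb deltaE; case: eqP => [e'|_]; last by rewrite scaler0.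
by rewrite yb xb e' eqxx in nb.
Qed.

Lemma freeDiff_part q j (x : freeMod q.+1) : mpart j x -> mpart j (freeDiff q x).
Proof.
move=> hx; exact: (tens_chain (gpart_pregraded A) (@rphi_part _ _ _ K q) hx).
Qed.

Section Augmented.
Variables (N : gradedMod A) (e : {linear freeMod 0 -> N}).
Hypothesis e_surj : forall n, exists f, e f = n.
Hypothesis e_part : forall j f, mpart j f -> mpart j (e f).
Hypothesis e_ker : forall j (f : freeMod 0), mpart j f ->
  e f = 0 <-> J j ((f : fsfam _ A^o) (r0 K)).

Lemma aug_exact0 j (f : freeMod 0) : mpart j f -> e f = 0 ->
  exists2 g, mpart j g & freeDiff 0 g = f.
Proof.
move=> hf /(e_ker hf)/(r_exact0 K)[g hg eg]; exists g => //.
by apply: (@fsfamP _ _ (tens _ g : fsfam _ A^o) f) => x; rewrite (r0_unique x).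
Qed.

Lemma aug_cx (g : freeMod 1) : e (freeDiff 0 g) = 0.
Proof.
rewrite [freeDiff 0 g](tens_lcomb (@rphi _ _ _ K 0) g) /lcomb /fsum raddf_sum big1// => x _ /=.
have -> : e (scalel (rphi x) (g x)) = ((g : fsfam _ A^o) x : A) *: e (rphi x).
  exact: linearZ_LR.
suff -> : e (rphi x) = 0 by rewrite scaler0.
by apply/(@e_ker (rdeg x) (rphi x) (@rphi_part _ _ _ K 0 x)); apply: rphi_J.
Qed.

Lemma minRes_resolution : graded_free_resolution freeDiff e.
Proof.
split=> //; [split=> //|exact: graded_free_freeMod|exact: freeDiff_part].
  move=> f; split=> [f0|[g <-]]; last exact: aug_cx.
  have /choice[g hg] : forall j, exists g, freeDiff 0 g = hcomp (mpart_grading (freeMod 0)) f j.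
    move=> j; have [||g _ <-] := @aug_exact0 j (hcomp (mpart_grading (freeMod 0)) f j).
    - exact: hcomp_part.
    - by rewrite -(hcomp_map _ _ e_part) f0 hcomp0.
    by exists g.
  have [us _ _ ef] := hcompP (mpart_grading (freeMod 0)) f.
  exists (\sum_(j <- hcomp_support (mpart_grading (freeMod 0)) f) g j).
  by rewrite raddf_sum [RHS]ef; apply: eq_bigr => j _; apply: hg.
move=> q f; split=> [f0|[g <-]]; last by apply: tens_comp0; apply: rphi_cx.
apply: (@tens_ungraded_exact k A _ _ _ (@rdeg _ _ _ K q.+1) (@rdeg _ _ _ K q)
    (@rdeg _ _ _ K q.+2)) f0; last exact: r_exact.
exact: rphi_part.
Qed.

(** By minimality k (x) K has zero differentials, so each basis element is a cycle, and it is no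
    boundary because 1 is not in A_+. *)
Lemma Tor_generator q (x : rX K q) : Tor_neq0 N q (rdeg x).
Proof.
exists freeMod, freeDiff, e; split; first exact: minRes_resolution.
exists (delta x (1 : A^o)); split.
- apply: chain_delta; first exact: gpart_pregraded.
  by rewrite subrr; apply: one_part.
- case: q x => //= q x; rewrite /freeDiff /= tens_delta1 (fs_delta (rphi x)).
  exists [seq (rphi x y, delta y (1 : A^o)) | y <- supp (rphi x)]; split.
    by move=> _ /mapP[y _ ->]; apply: rphi_irrelevant.
  rewrite big_map; apply: eq_bigr => y _; apply: fsfamP => z.
  rewrite fsZ !deltaE /=; case: eqP => _; last by rewrite scaler0.
  by rewrite /GRing.scale /= mulr1.
move=> [g /(irrelevant_mul_coord x)]; rewrite fsB deltaE eqxx => h.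
have := irrelevantD h (tens_irrelevant g x).
have {1}-> : 1 = (1 : k)%:A :> A by rewrite scale1r.
by rewrite subrK => /irrelevant_scalar/eqP; rewrite oner_eq0.
Qed.

End Augmented.

End MinResolution.

Section Residue.
Variables (k : fieldType) (A : gradedAlg k) (K : minRes (@posPart k A)).

Definition augMap (f : freeMod K 0) : residueMod A :=
  aug ((f : fsfam _ A^o) (r0 K) : A) : k.

Lemma augMap_linear : linear augMap.
Proof.
by move=> a f g; rewrite /augMap fsD fsZ augD; congr (_ + _); rewrite augM.
Qed.
HB.instance Definition _ :=
  GRing.isLinear.Build A (freeMod K 0) (residueMod A) _ augMap augMap_linear.

Lemma augMap_surj n : exists f, augMap f = n.
Proof.
exists (delta (r0 K) ((n : k)%:A : A^o)); rewrite /augMap deltaE eqxx.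
by apply: aug_unique; rewrite subrr; apply: irrelevant0.
Qed.

Lemma augMap_part j (f : freeMod K 0) : mpart j f -> mpart j (augMap f).
Proof.
move=> hf; suff : residue_part j (augMap f : residue A) by [].
move=> j0; apply: (@aug_pos _ _ j) => //.
by have := hf (r0 K); rewrite rdeg0 subr0.
Qed.

Lemma augMap_ker j (f : freeMod K 0) : mpart j f ->
  augMap f = 0 <-> posPart j ((f : fsfam _ A^o) (r0 K)).
Proof.
move=> hf; have := hf (r0 K); rewrite rdeg0 subr0 => hf0; split=> [f0|[_ h]].
  split=> // j0; have [ej|ne] := eqVneq j 0; last first.
    by apply: gpart_neg hf0; rewrite lt_neqAle ne.
  move: hf0; rewrite ej => /gpart0[c ec]; rewrite ec.
  suff -> : c = 0 by rewrite scale0r.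
  rewrite -f0 /augMap ec; apply/esym; apply: aug_unique.
  by rewrite subrr; apply: irrelevant0.
by apply: aug_unique; rewrite scale0r subr0; apply: gpart_irrelevant hf0 h.
Qed.

Lemma residue_resolution : graded_free_resolution (freeDiff K) augMap.
Proof.
exact: minRes_resolution augMap_surj augMap_part augMap_ker.
Qed.

Lemma residue_Tor q (x : rX K q) : Tor_neq0 (residueMod A) q (rdeg x).
Proof. exact: Tor_generator augMap_surj augMap_part augMap_ker _ _. Qed.

Lemma tau_residue q j : tau K (@mpart k A (residueMod A)) q j ->
  Tor_neq0 (residueMod A) q j.
Proof.
have res := residue_resolution.
move=> /(tau_balanced K q j (mpart_pregraded _) (graded_free_resolution_resolves res)) h.
by exists (freeMod K), (freeDiff K), augMap.
Qed.

(* The complex K (x) k has the matrices of K as differentials, and these vanish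
   in k: Tor(k, k) sits in the degrees of the generators of K. *)
Lemma residue_Tor_generator q j : Tor_neq0 (residueMod A) q j ->
  exists x : rX K q, rdeg x = j.
Proof.
move=> [F [d [e [res h]]]].
have : tau K (@mpart k A (residueMod A)) q j.
  by apply/(tau_balanced K q j (mpart_pregraded _) (graded_free_resolution_resolves res)).
move=> [f [hf _ nf]]; apply: contrapT => no; apply: nf; exists 0.
  by move=> x; apply: (pregraded0 (mpart_pregraded (residueMod A))).
rewrite raddf0; apply: fsfamP => x; apply/esym; apply: (hf x).
by rewrite subr_eq0 eq_sym; apply/eqP => e'; apply: no; exists x.
Qed.

End Residue.

Lemma Tor_tau (k : fieldType) (A : gradedAlg k) (K : minRes (@posPart k A))
    (N : gradedMod A) q j : Tor_neq0 N q j -> tau K (@mpart k A N) q j.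
Proof.
move=> [F [d [e [res h]]]].
by apply/(tau_balanced K q j (mpart_pregraded _) (graded_free_resolution_resolves res)).
Qed.

(** * Change of rings *)

(** Restriction of scalars for any R-module, as [restr] does it for R; the alias keeps the
    S-structure apart from the R-structure. *)
Definition pull (k : fieldType) (S R : gradedAlg k) (pi : {lrmorphism S -> R})
  (M : lmodType R) : Type := M.

Section Pull.
Variables (k : fieldType) (S R : gradedAlg k) (pi : {lrmorphism S -> R}).

Section Module.
Variable (M : lmodType R).

HB.instance Definition _ := GRing.Zmodule.copy (pull pi M) M.

Let scale (a : S) (x : pull pi M) : pull pi M := pi a *: (x : M).

Let scaleA a b x : scale a (scale b x) = scale (a * b) x.
Proof. by rewrite /scale scalerA rmorphM. Qed.
Let scale1 : left_id 1 scale.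
Proof. by move=> x; rewrite /scale rmorph1 scale1r. Qed.
Let scaleDr : right_distributive scale +%R.
Proof. by move=> a x y; rewrite /scale scalerDr. Qed.
Let scaleDl x : {morph scale^~ x : a b / a + b}.
Proof. by move=> a b; rewrite /scale rmorphD scalerDl. Qed.

HB.instance Definition _ :=
  GRing.Zmodule_isLmodule.Build S (pull pi M) scaleA scale1 scaleDr scaleDl.

Lemma pullZ (a : S) (x : M) : a *: (x : pull pi M) = pi a *: x :> M.
Proof. by []. Qed.

Lemma pull_pregraded (Z : int -> set M) :
  (forall j (a : S), gpart j a -> gpart j (pi a)) ->
  pregraded Z -> pregraded (Z : int -> set (pull pi M)).
Proof.
move=> hpi pZ; split=> [j|j x y|i j a x ha hx].
- exact: (pregraded0 pZ).
- exact: (pregradedB pZ).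
by rewrite pullZ; apply: (pregradedZ pZ (hpi _ _ ha) hx).
Qed.

End Module.

Definition pull_map (M N : lmodType R) (v : {linear M -> N}) (x : pull pi M) :
  pull pi N := v x.
Lemma pull_map_linear (M N : lmodType R) (v : {linear M -> N}) :
  linear (pull_map v).
Proof. by move=> a x y; rewrite /pull_map pullZ linearP. Qed.
HB.instance Definition _ (M N : lmodType R) (v : {linear M -> N}) :=
  GRing.isLinear.Build S (pull pi M) (pull pi N) _ (pull_map v)
    (pull_map_linear v).

Section Coordinates.
Variables (X : choiceType) (x : X).

Definition pull_delta (r : restr pi) : pull pi (fsfam X R^o) :=
  delta x (r : R^o).
Lemma pull_delta_linear : linear pull_delta.
Proof.
move=> a r s; apply: (@fsfamP X R^o) => y.
rewrite fsD pullZ fsZ !deltaE; case: eqP => // _.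
by rewrite scaler0 addr0.
Qed.
HB.instance Definition _ :=
  GRing.isLinear.Build S (restr pi) (pull pi (fsfam X R^o)) _ pull_delta
    pull_delta_linear.

Definition pull_coord (f : pull pi (fsfam X R^o)) : restr pi :=
  (f : fsfam X R^o) x.
Lemma pull_coord_linear : linear pull_coord.
Proof. by move=> a f g; rewrite /pull_coord fsD pullZ fsZ. Qed.
HB.instance Definition _ :=
  GRing.isLinear.Build S (pull pi (fsfam X R^o)) (restr pi) _ pull_coord
    pull_coord_linear.

End Coordinates.

Lemma pull_dual_basis (X : choiceType) (dg : X -> int) :
  dual_basis (range dg) (@gpart k R : int -> set (restr pi))
    (chain dg (@gpart k R : int -> set R^o) : int -> set (pull pi (fsfam X R^o))).
Proof.
have pR := gpart_pregraded R.
apply: (@dual_basis_family k S X setT dg _ _ _ _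
  (fun x => pull_delta x) (fun x => pull_coord x)).
- by move=> x j r _ hr; apply: chain_delta => //; rewrite addrK.
- by move=> x j f _; apply.
move=> f; exists (supp (f : fsfam X R^o)); split=> //.
- exact: supp_uniq.
- by move=> x /suppP.
exact: (fs_delta (f : fsfam X R^o)).
Qed.

End Pull.

Section ChangeOfRings.
Variables (k : fieldType) (S R : gradedAlg k) (I : set S).
Variables (pi : {lrmorphism S -> R}) (quotR : graded_quotient I pi).
Hypothesis linearS : forall q j, Tor_neq0 (residueMod S) q j -> j <= q%:Z.

Let RS := restrMod (quot_hom quotR).
Let kR := residueMod R.

Definition idealPart (j : int) : set S := [set a | gpart j a /\ pi a = 0].

Lemma idealPart_pregraded : pregraded (idealPart : int -> set S^o).
Proof.
have pA := gpart_pregraded S.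
split=> [j|j x y [hx x0] [hy y0]|i j a x ha [hx x0]].
- by split; [apply: (pregraded0 pA)|rewrite raddf0].
- by split; [apply: (pregradedB pA)|rewrite raddfB /= x0 y0 subrr].
by split; [apply: gpart_mul|rewrite rmorphM /= x0 mulr0].
Qed.

(** R is nonzero, so the kernel of [pi] contains no nonzero scalar. *)
Lemma idealPart0 a : idealPart 0 a -> a = 0.
Proof.
move=> [/gpart0[c ->]]; rewrite linearZ /= rmorph1 => /eqP.
by rewrite scaler_eq0 oner_eq0 orbF => /eqP ->; rewrite scale0r.
Qed.

Lemma gpart_lift j (r : R) : gpart j r -> exists2 a : S, gpart j a & pi a = r.
Proof.
move=> hr; have [a ea] := quot_surj quotR r.
exists (hcomp (gpart_grading S) a j); first exact: hcomp_part.
have [us hc cs e] := hcompP (gpart_grading S) a.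
rewrite -(hcomp_id (gpart_grading R) hr) -ea; apply/esym.
apply: (@hcomp_unique _ _ (gpart_grading R) _ (hcomp_support (gpart_grading S) a)
  (fun j => pi (hcomp (gpart_grading S) a j))) => //.
- by move=> n; apply: (quot_hom quotR).
- by move=> n /cs ->; rewrite raddf0.
by rewrite {1}e raddf_sum.
Qed.

Section QuotientResolution.
Variable (H : minRes idealPart).

Definition quotMap (f : freeMod H 0) : RS := pi ((f : fsfam _ S^o) (r0 H)).
Lemma quotMap_linear : linear quotMap.
Proof. by move=> a f g; rewrite /quotMap fsD raddfD; congr (_ + _); apply: rmorphM. Qed.
HB.instance Definition _ :=
  GRing.isLinear.Build S (freeMod H 0) RS _ quotMap quotMap_linear.

Lemma quotMap_surj n : exists f, quotMap f = n.
Proof.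
have [a ea] := quot_surj quotR n.
by exists (delta (r0 H) (a : S^o)); rewrite /quotMap deltaE eqxx.
Qed.

Lemma quotMap_part j (f : freeMod H 0) : mpart j f -> mpart j (quotMap f).
Proof.
move=> hf; apply: (quot_hom quotR).
by have := hf (r0 H); rewrite rdeg0 subr0.
Qed.

Lemma quotMap_ker j (f : freeMod H 0) : mpart j f ->
  quotMap f = 0 <-> idealPart j ((f : fsfam _ S^o) (r0 H)).
Proof.
move=> hf; split=> [f0|[_]//]; split=> //.
by have := hf (r0 H); rewrite rdeg0 subr0.
Qed.

Lemma quotient_resolution : graded_free_resolution (freeDiff H) quotMap.
Proof. exact: minRes_resolution quotMap_surj quotMap_part quotMap_ker. Qed.

Lemma quotient_Tor q (x : rX H q) : Tor_neq0 RS q (rdeg x).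
Proof. exact: Tor_generator quotMap_surj quotMap_part quotMap_ker _ _. Qed.

End QuotientResolution.

Lemma idealRes_exists : exists _ : minRes idealPart, True.
Proof.
by apply: minRes_exists; [exact: idealPart_pregraded|by move=> j a []|exact: idealPart0].
Qed.

Lemma posRes_exists (A : gradedAlg k) : exists _ : minRes (@posPart k A), True.
Proof.
apply: minRes_exists; [exact: posPart_pregraded|by move=> j a []|].
by move=> a [_]; apply.
Qed.

(** * Syzygies of k over R and the two degree bounds *)

Section Syzygies.
Variables (K : minRes (@posPart k S)) (G : minRes (@posPart k R)) (H : minRes idealPart).

Lemma tau_quotient q j : tau K (@gpart k R : int -> set (restr pi)) q j ->
  Tor_neq0 RS q j.
Proof.
have res := quotient_resolution H.
move=> /(tau_balanced K q j (mpart_pregraded RS)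
  (graded_free_resolution_resolves res)) h.
by exists (freeMod H), (freeDiff H), (@quotMap H).
Qed.

Definition GS p := pull pi (fsfam (rX G p) R^o).
Definition GSpart p : int -> set (GS p) :=
  chain (@rdeg _ _ _ G p) (@gpart k R : int -> set R^o).

Lemma GSpart_pregraded p : pregraded (@GSpart p).
Proof.
apply: pull_pregraded (quot_hom quotR) _.
exact: chain_pregraded (gpart_pregraded R).
Qed.

(** Over S, G_p is a sum of copies of R shifted by the degrees of its generators, and each such
    degree occurs in Tor_p^R(k, k). *)
Lemma tau_GS p q j : tau K (@GSpart p) q j ->
  exists2 a, Tor_neq0 kR p a & Tor_neq0 RS q (j - a).
Proof.
have db := pull_dual_basis (pi := pi) (@rdeg _ _ _ G p).
move=> /(tau_dual_basis (@GSpart_pregraded p) db)[_ [x _ <-] h].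
by exists (rdeg x); [exact: residue_Tor|exact: tau_quotient].
Qed.

Definition kS := pull pi kR.
Definition kSpart : int -> set kS := @mpart k R kR.

Lemma kSpart_pregraded : pregraded kSpart.
Proof. exact: pull_pregraded (quot_hom quotR) (mpart_pregraded kR). Qed.

Lemma aug_quotient (a : S) : aug (pi a) = aug a.
Proof.
apply: aug_unique; have [s [hs e]] := augP a.
have -> : pi a - (aug a)%:A = pi (a - (aug a)%:A).
  by rewrite raddfB /=; congr (_ - _); rewrite linearZ /= rmorph1.
rewrite e raddf_sum; apply: irrelevant_sum => p /hs[p0 hp].
by apply: irrelevant_hom p0 _; apply: (quot_hom quotR).
Qed.

Definition resid_to (x : residueMod S) : kS := (x : k) : residue R.
Lemma resid_to_linear : linear resid_to.
Proof. by move=> a x y; congr (_ + _); congr (_ * _); rewrite aug_quotient. Qed.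
HB.instance Definition _ :=
  GRing.isLinear.Build S (residueMod S) kS _ resid_to resid_to_linear.

Definition resid_from (x : kS) : residueMod S := (x : k) : residue S.
Lemma resid_from_linear : linear resid_from.
Proof. by move=> a x y; congr (_ + _); congr (_ * _); rewrite aug_quotient. Qed.
HB.instance Definition _ :=
  GRing.isLinear.Build S kS (residueMod S) _ resid_from resid_from_linear.

(** Restricting k from R to S gives the residue field of S, through a dual basis with one element;
    this is where Koszulness of S enters. *)
Lemma tau_kS q j : tau K kSpart q j -> j <= q%:Z.
Proof.
have db : dual_basis [set 0] (@mpart k S (residueMod S)) kSpart.
  move=> s; exists 1%N, (fun=> resid_to), (fun=> resid_from), (fun=> 0).
  split=> // [_ n x|_ n x|m _]; rewrite ?addr0 ?subr0// big_ord1.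
  by [].
move=> /(tau_dual_basis kSpart_pregraded db)[_ ->].
by rewrite subr0 => /tau_residue/linearS.
Qed.

(* Syzygies of k over R, regarded as modules over S. *)
Definition amb p : lmodType S := match p with 0%N => kS | p'.+1 => GS p' end.

Definition syzMap p : {linear GS p -> amb p} :=
  match p return {linear GS p -> amb p} with
  | 0%N => pull_map (pi := pi) (@augMap k R G)
  | p'.+1 => pull_map (pi := pi) (tens (@rphi _ _ _ G p'))
  end.

Definition syzPart p : int -> set (amb p) :=
  match p return int -> set (amb p) with
  | 0%N => kSpart
  | p'.+1 => fun j => [set x | GSpart j x /\ syzMap p' x = 0]
  end.

Lemma syz_ses p : ses (@syzPart p.+1) (@GSpart p) (@syzPart p) (syzMap p).
Proof.
split=> //; first exact: GSpart_pregraded.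
- case: p => [|p] j x hx; first exact: augMap_part.
  split; first exact: tens_chain (gpart_pregraded R) (@rphi_part _ _ _ G p) hx.
  case: p x hx => [|p] x hx; first exact: (aug_cx (@augMap_ker k R G)).
  by apply: tens_comp0; apply: rphi_cx.
case: p => [|p] j y.
  move=> hy; have [x ex] := @augMap_surj k R G y.
  exists (hcomp (mpart_grading (freeMod G 0)) x j); first exact: hcomp_part.
  exact: (graded_lift (@augMap_part k R G) hy ex).
case: p y => [|p] y [hy y0]; first exact: (aug_exact0 (@augMap_ker k R G) hy y0).
exact: r_exact hy y0.
Qed.
(** A class of T_q(Z_p) either lifts to G_p or connects to T_(q-1)(Z_(p+1)). The sum p + q is
    preserved, and right exactness of T_0 ends the descent. *)
Lemma tau_syz_tail q : forall p j, tau K (@syzPart p) q j ->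
  exists p' q' a b, [/\ (p' + q' = p + q)%N, (p <= p')%N, a + b = j,
    Tor_neq0 kR p' a & Tor_neq0 RS q' b].
Proof.
elim: q => [|q IH] p j h.
  have [a ha hb] := tau_GS (tau_quot0 (syz_ses p) h).
  by exists p, 0%N, a, (j - a); split=> //; ring.
have [/tau_GS[a ha hb]|[f [h1 h2 h3 _]]] := tau_quotS (syz_ses p) h.
  by exists p, q.+1, a, (j - a); split=> //; ring.
have [|p' [q' [a [b [e le eab ha hb]]]]] := IH p.+1 j; first by exists f.
exists p', q', a, b; split=> //; first by rewrite e addSnnS.
exact: ltnW.
Qed.

(** A class of T_q(Z_p) either survives in G_(p-1) or comes from T_(q+1)(Z_(p-1)). The descent
    cannot reach Z_0 = k, because j > p + q persists and exceeds the bound for k. *)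
Lemma tau_syz_head p : forall q j, (0 < q)%N -> (q + p)%:Z < j ->
  tau K (@syzPart p) q j ->
  exists p' q' a b, [/\ (p' + q').+1 = (p + q)%N, (0 < q')%N, a + b = j,
    Tor_neq0 kR p' a & Tor_neq0 RS q' b].
Proof.
elim: p => [|p IH] q j q0 lt h.
  by have := tau_kS h; move: lt; rewrite addn0; lia.
have [/tau_GS[a ha hb]|/(tauB_quot (syz_ses p)) h'] := tau_sub (syz_ses p) h.
  by exists p, q, a, (j - a); split=> //; ring.
have lt' : (q.+1 + p)%:Z < j by rewrite addSnnS.
have [p' [q' [a [b [e q'0 eab ha hb]]]]] := IH q.+1 j isT lt' h'.
by exists p', q', a, b; split=> //; rewrite e addSnnS.
Qed.

Lemma bnd_sum (M : lmodType S) (Z : int -> set M) q j (T : eqType) (r : seq T)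
    (F : T -> fsfam (rX K q) M) : pregraded Z ->
  (forall x, x \in r -> bnd Z j (F x)) -> bnd Z j (\sum_(x <- r) F x).
Proof.
move=> pZ h; rewrite big_seq; elim/big_ind: _ => [|f g [u hu <-] [v hv <-]|//].
  exists 0; first exact: (pregraded0 (chain_pregraded _ pZ)).
  by rewrite raddf0.
exists (u + v); first exact: (pregradedD (chain_pregraded _ pZ)).
by rewrite raddfD.
Qed.

(* Minimality: the entries of G 1 -> G 0 lie in R_+, which annihilates
   Tor(k, R). *)
Lemma bnd_syzMap1 q j (w : fsfam (rX K q) (GS 1)) :
  chain (@rdeg _ _ _ K q) (@GSpart 1) j w -> cyc w ->
  bnd (@GSpart 0) j (fmap (syzMap 1) w).
Proof.
move=> hw cw; pose T : seq (rX G 1) :=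
  undup (flatten [seq supp (w x : fsfam _ R^o) | x <- supp w]).
have offT x y : y \notin T -> (w x : fsfam _ R^o) y = 0.
  move=> yT; have [xs|/suppP ->//] := boolP (x \in supp w).
  apply: suppP; apply: contra yT => ys; rewrite mem_undup.
  by apply/flattenP; exists (supp (w x : fsfam _ R^o)) => //; apply: map_f.
(* The entries of G 1 -> G 0 are lifted to S, since [tau_annihilated] concerns the action of S. *)
have /choice[s hs] : forall y : rX G 1, exists a : S,
    [/\ gpart (rdeg y) a, pi a = rphi y (r0 G) & rdeg y <= 0 -> a = 0].
  move=> y; have [h h0] := rphi_J y; have [y0|y0] := ltP 0 (rdeg y).
    by have [a ha ea] := gpart_lift h; exists a.
  exists 0; rewrite raddf0 h0//; split=> //.
  exact: (pregraded0 (gpart_pregraded S)).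
have -> : fmap (syzMap 1) w = \sum_(y <- T) s y *:
    fmap (pull_delta (pi := pi) (r0 G)) (fmap (pull_coord (pi := pi) y) w).
  apply: fsfamP => x; rewrite fs_sum fmapE.
  apply: (@fsfamP _ R^o) => z; rewrite (r0_unique z).
  rewrite [LHS](@tensE _ _ _ (@rphi _ _ _ G 0) R^o T) ?undup_uniq//; last first.
    by move=> y; apply: offT.
  rewrite [RHS](_ : _ = \sum_(y <- T) (s y *: (pull_delta (pi := pi) (r0 G)
     (pull_coord (pi := pi) y (w x))) : fsfam _ R^o) (r0 G)); last exact: fs_sum.
  apply: eq_bigr => y _; have [_ <- _] := hs y.
  by rewrite pullZ fsZ /pull_delta deltaE eqxx.
apply: bnd_sum => [|y _]; first exact: GSpart_pregraded.
have [h1 _ h2] := hs y; have [y0|y0] := ltP 0 (rdeg y); last first.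
  rewrite h2// scale0r; exists 0; last by rewrite raddf0.
  exact: (pregraded0 (chain_pregraded _ (@GSpart_pregraded 0))).
have hc : chain (@rdeg _ _ _ K q) (@gpart k R : int -> set (restr pi))
    (j - rdeg y) (fmap (pull_coord (pi := pi) y) w).
  by apply: chain_fmap hw => n x; apply.
have res := graded_free_resolution_resolves (quotient_resolution H).
have [g hg eg] := tau_annihilated (K := K) (mpart_pregraded RS) res y0 h1 hc
  (cyc_fmap _ cw).
exists (fmap (pull_delta (pi := pi) (r0 G)) g).
  have -> : j = (rdeg y + (j - rdeg y)) + 0 by ring.
  apply: chain_fmap hg => n x hx; rewrite addr0.
  apply: chain_delta; first exact: gpart_pregraded.
  by rewrite rdeg0 subr0.
by rewrite tens_fmap eg linearZ.
Qed.

Lemma Tor_quotient_bound i j : Tor_neq0 RS i j -> i%:Z < j ->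
  exists p q a b, [/\ (p + q = i.+1)%N, (2 <= p)%N, a + b = j,
    Tor_neq0 kR p a & Tor_neq0 RS q b].
Proof.
move=> /(Tor_tau K); case: i => [|i] h ij.
  (* R is generated over S by 1, so T_0(R) vanishes in positive degrees. *)
  have [m hm nm] := (proj1 (tau0 K j (mpart_pregraded RS))) h.
  case: nm; have [a ha ea] := gpart_lift (hm : gpart j (m : R)).
  have -> : m = a *: ((1 : R) : RS).
    by rewrite -ea -[LHS]mulr1.
  by apply: irrhM ij ha _; rewrite subrr; apply: one_part.
have [f [hf cf nf]] := h.
have hf0 : chain (@rdeg _ _ _ K i.+1) (@GSpart 0) j
    (fmap (pull_delta (pi := pi) (r0 G)) f).
  rewrite -[j]addr0; apply: chain_fmap hf => n x hx.
  rewrite addr0; apply: chain_delta; first exact: gpart_pregraded.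
  by rewrite rdeg0 subr0.
have nk : ~ tau K kSpart i.+1 j by move=> /tau_kS; lia.
have [||b [hb cb nb]] := tau_mid (syz_ses 0) nk hf0.
- exact: cyc_fmap.
(* G 0 has rank one; reading off its coordinate turns a bounding chain there into one for [f]. *)
- move=> [g hg eg]; apply: nf.
  exists (fmap (pull_coord (pi := pi) (r0 G)) g).
    by move=> x; have := hg x (r0 G); rewrite rdeg0 subr0.
  rewrite tens_fmap eg; apply: fsfamP => x.
  by rewrite !fmapE /= /pull_coord /pull_delta /= eqxx.
have [[w [hw cw ew]]|[u [h1 h2 h3 _]]] := cyc_lift (syz_ses 1) hb cb.
  by case: nb; rewrite -ew; apply: bnd_syzMap1.
have [|p [q [a [c [e le eac ha hc]]]]] := @tau_syz_tail i 2 j; first by exists u.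
by exists p, q, a, c; split.
Qed.

(** Elements of Z_(l+1) lift to G_(l+1), so elements of S_+ Z_(l+1) lift with coordinates in R_+. *)
Lemma irrh_syz l j (m : GS l) : irrh (@syzPart l.+1) j m ->
  exists g : fsfam (rX G l.+1) R^o,
  [/\ chain (@rdeg _ _ _ G l.+1) (@gpart k R : int -> set R^o) j g,
      tens (@rphi _ _ _ G l) g = m & forall y, irrelevant (g y : R)].
Proof.
have pC := chain_pregraded (@rdeg _ _ _ G l.+1) (gpart_pregraded R).
elim=> [|x y _ [g [g1 <- g3]] _ [h [h1 <- h3]]|i a z i0 ha hz].
- exists 0; split; [exact: (pregraded0 pC)|by rewrite raddf0|].
  by move=> y; apply: irrelevant0.
- exists (g + h); split; [exact: (pregradedD pC)|by rewrite raddfD|].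
  by move=> u; apply: irrelevantD.
have [_ _ _ surj] := syz_ses l.+1; have [h hh eh] := surj _ _ hz.
exists (pi a *: (h : fsfam _ R^o)); split.
- by apply: (pregradedZ pC (quot_hom quotR ha) hh); ring.
- by rewrite linearZ /= pullZ -eh.
move=> y; rewrite fsZ; apply: irrelevantM.
by apply: irrelevant_hom i0 _; apply: (quot_hom quotR).
Qed.

(** The row of [x] is a minimal generator of Z_(l+1), so its class in T_0(Z_(l+1)) is nonzero. Its
    entries lie in R_+, so it dies in T_0(G_l) and comes from T_1(Z_l). *)
Lemma tau_generator l (x : rX G l.+1) : tau K (@syzPart l) 1 (rdeg x).
Proof.
apply: (tauB_quot (syz_ses l)).
have pS := GSpart_pregraded; have [pZ sub _ _] := syz_ses l.
have hx : syzPart (p := l.+1) (rdeg x) (rphi x : GS l).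
  have [_ _ img _] := syz_ses l.+1.
  rewrite -(tens_delta1 (@rphi _ _ _ G l)).
  apply: (img _ (delta x (1 : R^o) : GS l.+1)).
  apply: chain_delta; first exact: gpart_pregraded.
  by rewrite subrr; apply: one_part.
have pZ' : pregraded (@syzPart l.+1).
  split=> [j|j u v /sub[hu u0] /sub[hv v0]|i j a u ha /sub[hu u0]]; apply/sub.
  - by split; [apply: (pregraded0 pZ)|rewrite raddf0].
  - by split; [apply: (pregradedB pZ)|rewrite raddfB /= u0 v0 subrr].
  by split; [apply: (pregradedZ pZ ha hu)|rewrite linearZ /= u0 scaler0].
apply/(tauB0 K (rdeg x) pZ' pZ); exists (rphi x : GS l); split=> //.
  move=> /irrh_syz[g [hg eg ig]].
  (* Otherwise [delta x 1 - g] is a syzygy, hence has coordinates in R_+ by minimality of the next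
     matrix; as [g] does too, 1 would lie in R_+. *)
  have [_ _ _ surj] := syz_ses l.+2.
  have [|v _ ev] := surj (rdeg x) (delta x (1 : R^o) - g : GS l.+1).
    split; last by rewrite /= /pull_map raddfB /= tens_delta1 eg subrr.
    apply: (pregradedB (@GSpart_pregraded l.+1)) => //.
    apply: chain_delta; first exact: gpart_pregraded.
    by rewrite subrr; apply: one_part.
  have iv : irrelevant ((delta x (1 : R^o) - g) x : R).
    by rewrite -ev; apply: tens_irrelevant.
  have := irrelevantD iv (ig x); rewrite fsB deltaE eqxx.
  have {1}-> : 1 = (1 : k)%:A :> R by rewrite scale1r.
  by rewrite subrK => /irrelevant_scalar/eqP; rewrite oner_eq0.
rewrite [X in irrh _ _ X](fs_delta (rphi x)).
apply: irrh_sum => y _.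
have hy := rphi_part x y.
have [lt|ge] := ltP (rdeg y) (rdeg x); last first.
  suff -> : delta y (rphi x y) = 0 :> GS l by apply: irrh0.
  apply: (@fsfamP _ R^o) => z; rewrite deltaE; case: eqP => // _.
  have [e|ne] := eqVneq (rdeg x) (rdeg y); first exact: rphi_min.
  by apply: gpart_neg hy; rewrite subr_lt0 lt_neqAle ne.
have [a ha ea] := gpart_lift hy.
have -> : delta y (rphi x y) = a *: (delta y (1 : R^o) : GS l) :> GS l.
  apply: (@fsfamP _ R^o) => z; rewrite pullZ fsZ !deltaE -ea.
  by case: eqP => _; rewrite ?scaler0// /GRing.scale /= mulr1.
apply: irrhM ha _; first by rewrite subr_gt0.
apply: chain_delta; first exact: gpart_pregraded.
by rewrite subKr subrr; apply: one_part.
Qed.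

Lemma Tor_residue_bound l j : Tor_neq0 kR l j -> l%:Z < j ->
  exists p q a b, [/\ (p + q).+1 = l, (0 < q)%N, a + b = j,
    Tor_neq0 kR p a & Tor_neq0 RS q b].
Proof.
move=> /(residue_Tor_generator G)[x <-]; case: l x => [|l] x.
  by rewrite (r0_unique x) rdeg0.
move=> lt; have {}lt : (1 + l)%:Z < rdeg x by rewrite add1n.
have [p [q [a [b [e q0 eab ha hb]]]]] := tau_syz_head (ltn0Sn 0) lt (tau_generator x).
by exists p, q, a, b; split=> //; rewrite e addn1.
Qed.

Lemma quotient_Tor0 : Tor_neq0 RS 0 0.
Proof. by rewrite -(rdeg0 H); apply: quotient_Tor. Qed.

Lemma residue_Tor0 : Tor_neq0 kR 0 0.
Proof. by rewrite -(rdeg0 G); apply: residue_Tor. Qed.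

(** The generators of the minimal resolution H in homological degree 1 map to generators of I and
    all contribute to Tor_1. If none has degree at least 2, the nonzero ones are linear forms. *)
Lemma Tor1_nonlinear : ~ linearly_generated I ->
  exists2 j : int, 2 <= j & Tor_neq0 RS 1 j.
Proof.
move=> nl; apply: contrapT => no; apply: nl => y Iy.
have small (x : rX H 1) : rdeg x < 2.
  by rewrite ltNge; apply/negP => le; apply: no; exists (rdeg x) => //; apply: quotient_Tor.
pose lin (z : S) := exists s : seq (S * S),
    (forall p, p \in s -> I p.2 /\ gpart 1 p.2) /\ z = \sum_(p <- s) p.1 * p.2.
have lin_sum (T : Type) (r : seq T) (F : T -> S) :
    (forall x, lin (F x)) -> lin (\sum_(x <- r) F x).
  move=> h; elim/big_ind: _ => [|u v [s [hs ->]] [t [ht ->]]|//].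
    by exists [::]; rewrite big_nil.
  exists (s ++ t); rewrite big_cat; split=> // p.
  by rewrite mem_cat => /orP[/hs|/ht].
have [_ _ _ e] := hcompP (gpart_grading S) y.
rewrite -/(lin y) e; apply: (@lin_sum) => j.
have hj : idealPart j (hcomp (gpart_grading S) y j).
  split; first exact: hcomp_part.
  have [us _ cs e'] := hcompP (gpart_grading S) y.
  rewrite -(@hcomp_unique _ _ (gpart_grading R) (pi y) (hcomp_support (gpart_grading S) y)
    (fun j => pi (hcomp (gpart_grading S) y j))) //.
  - by rewrite (proj2 (quot_ker quotR y) Iy) hcomp0.
  - by move=> n; apply: (quot_hom quotR); apply: hcomp_part.
  - by move=> n /cs ->; rewrite raddf0.
  by rewrite {1}e' raddf_sum.
have [f _ <-] := r_exact0 H hj; rewrite tensE_supp; apply: lin_sum => x.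
have [hx x0] := rphi_J x.
exists [:: (f x : S, rphi x (r0 H) : S)]; rewrite big_seq1; split; last exact: mulrC.
move=> p; rewrite inE => /eqP -> /=; split; first exact/(quot_ker quotR).
have [e1|ne] := eqVneq (rdeg x) 1; first by rewrite -e1.
suff -> : rphi x (r0 H) = 0 by apply: (pregraded0 (gpart_pregraded S)).
have [e0|ne0] := eqVneq (rdeg x) 0; first by apply: idealPart0; rewrite -e0.
by apply: gpart_neg hx; move: (small x) ne ne0; lia.
Qed.

(** [pdim] allows ungraded projective resolutions, so the graded class is first compared with the
    ungraded Tor. *)
Lemma Tor_projective_dimension (P : nat -> lmodType S)
    (d : forall i, {linear P i.+1 -> P i}) (e : {linear P 0 -> RS}) (n : int) q j :
  is_resolution d e -> (forall i, projective (P i)) ->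
  (forall i : nat, n < i%:Z -> forall x : P i, x = 0) ->
  Tor_neq0 RS q j -> q%:Z <= n.
Proof.
move=> [surj e0 ed] pP Pn /(Tor_tau K)/tau_forget_grading h.
rewrite leNgt; apply/negP => nq.
apply: (@tau_projective_resolution _ _ K q _ P d e j e0 ed pP (Pn q nq)).
have -> : range e = [set: RS]; last exact: h.
by rewrite predeqE => y; split=> // _; have [x ex] := surj y; exists x.
Qed.

End Syzygies.

End ChangeOfRings.

(** * Regularity *)

Section ExtendedInt.
Implicit Types (E : set (\bar int)).

Lemma ebar_int_supremums E : supremums E !=set0.
Proof.
have [[n nE]|noub] := pselect (exists n : int, ubound E n%:E); last first.
  exists +oo%E; split=> [x _|[y| |] hy]; rewrite ?leey//.
    by case: noub; exists y.
  case: noub; exists 0 => x Ex; apply: le_trans (hy x Ex) _; exact: leNye.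
have [[m Em]|nofin] := pselect (exists m : int, E m%:E); last first.
  exists -oo%E; split=> [[x| |] Ex|y _]; rewrite ?leNye//.
    by case: nofin; exists x.
  by have := nE _ Ex; rewrite leye_eq.
have mn : m <= n by rewrite -lee_fin; apply: nE.
(* The supremum is [m + d] for the least natural number [d] making this an upper bound. *)
have ex : exists d, `[< ubound E (m + d%:Z)%:E >].
  exists `|n - m|%N; apply/asboolP; rewrite (_ : m + _ = n)//; lia.
have [d /asboolP dE dmin] := ex_minnP ex.
exists (m + d%:Z)%:E; split=> // -[y| |] hy; rewrite ?leey//.
  have my : m <= y by rewrite -lee_fin; apply: hy.
  have /dmin : `[< ubound E (m + `|y - m|%N%:Z)%:E >].
    by apply/asboolP; rewrite (_ : m + _ = y)//; lia.
  by rewrite lee_fin; lia.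
by have := hy _ Em; rewrite leeNy_eq.
Qed.

Lemma le_supremum_ebar E x : E x -> (x <= supremum -oo E)%E.
Proof. by move=> Ex; apply: ge_supremum_Nmem => //; apply: ebar_int_supremums. Qed.

Lemma supremum_ebar_le E y : (forall x, E x -> (x <= y)%E) -> (supremum -oo E <= y)%E.
Proof.
move=> hy; rewrite /supremum; case: ifPn => _; first exact: leNye.
by case: xgetP => [x _ [_]|_]; [apply|exact: leNye].
Qed.

Lemma infimum_int_attained (P : set int) (q : int) :
  infimum +oo%E [set n%:E | n in P] = q%:E -> exists2 n, P n & n <= q.
Proof.
rewrite /infimum; case: ifPn => // _; case: xgetP => // x -> [_ glb] [e].
apply: contrapT => no; have := glb (q + 1)%:E; rewrite e lee_fin => h.
suff : q + 1 <= q by lia.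
apply: h => _ [n Pn <-]; rewrite lee_fin.
by have [|lt] := leP n q; [move=> le; case: no; exists n|lia].
Qed.

End ExtendedInt.

Section RegularityBounds.
Variables (k : fieldType) (A : gradedAlg k) (N : gradedMod A).

Lemma Tor_le_reg i j n : (i <= n)%N -> Tor_neq0 N i j ->
  ((j - i%:Z)%:E <= reg_upto N n)%E.
Proof.
move=> le h; have lt : (i < n.+1)%N by [].
rewrite /reg_upto (bigD1 (Ordinal lt))//= le_max; apply/orP; left.
by rewrite EFinD; apply: leeD2r; apply: le_supremum_ebar; exists j.
Qed.

Lemma reg_upto_le n y :
  (forall i j, (i <= n)%N -> Tor_neq0 N i j -> ((j - i%:Z)%:E <= y)%E) ->
  (reg_upto N n <= y)%E.
Proof.
move=> h; rewrite /reg_upto; elim/big_ind: _ => [|u v hu hv|i _].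
- exact: leNye.
- by rewrite ge_max hu.
rewrite leeBlDr//; apply: supremum_ebar_le => _ [j hj <-].
by rewrite -leeBlDr// -EFinB; apply: h => //; rewrite -ltnS.
Qed.

Lemma tor_top_le i : (tor_top N i <= reg_upto N i + (i%:Z)%:E)%E.
Proof.
apply: supremum_ebar_le => _ [j hj <-].
by rewrite -leeBlDr// -EFinB; apply: Tor_le_reg.
Qed.

Lemma reg_upto_ge0 n : Tor_neq0 N 0 0 -> (0 <= reg_upto N n)%E.
Proof. by move=> /(Tor_le_reg (leq0n n)); rewrite subr0. Qed.

Lemma reg_upto_le_reg n : (reg_upto N n <= reg N)%E.
Proof. by apply: le_supremum_ebar; exists n. Qed.

End RegularityBounds.

Lemma Koszul_Tor (k : fieldType) (A : gradedAlg k) : Koszul A ->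
  forall q j, Tor_neq0 (residueMod A) q j -> j <= q%:Z.
Proof.
move=> h q j /(Tor_le_reg (leqnn q)) le.
by have := le_trans le (reg_upto_le_reg _ q); rewrite [reg _]h lee_fin subr_le0.
Qed.

Local Close Scope classical_set_scope.

Theorem corollary2p4 (k : fieldType) (S : gradedAlg k)
    (standardS : standard_graded S) (koszulS : Koszul S)
    (I : set S) (homI : homogeneous_ideal I)
    (R : gradedAlg k) (pi : {lrmorphism S -> R})
    (quotR : graded_quotient I pi) :
  let RS : gradedMod S := restrMod (quot_hom quotR) in
  let kR : gradedMod R := residueMod R in
  let p : \bar int := pdim RS in
  [/\ forall i : nat,
        (tor_top RS i
          <= ((2 * i)%N%:Z)%:E + \sum_(2 <= j < i.+2) reg_upto kR j)%E,
      forall i : nat, (0 < i)%N ->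
        (reg_upto RS i <= reg_upto RS i.-1 + reg_upto kR i.+1 + 1%:E)%E,
      (forall i : nat, (0 < i)%N -> ((i%:Z)%:E <= p)%E ->
         ~ linearly_generated I \/ (0 < reg_upto RS i)%E ->
         (reg_upto kR i.+1 <= reg_upto RS i + reg_upto kR i.-1 - 1%:E)%E)
      /\
      (forall q : nat, p = (q%:Z)%:E ->
         ~ linearly_generated I \/ (0 < reg_upto RS q)%E ->
         forall i : nat, (0 < i)%N -> (q <= i)%N ->
         (reg_upto kR i.+1 <= reg_upto RS q + reg_upto kR i.-1 - 1%:E)%E)
    & reg RS = 1%:E -> Koszul R].
Proof.
move=> RS kR p.
have linS := Koszul_Tor koszulS.
have [K _] := posRes_exists S; have [G _] := posRes_exists R.
have [H _] := idealRes_exists pi.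
have RS00 : Tor_neq0 RS 0 0 := quotient_Tor0 quotR H.
have kR00 : Tor_neq0 kR 0 0 := residue_Tor0 G.
have boundRS i j := @Tor_quotient_bound k S R I pi quotR linS K G H i j.
have boundkR l j := @Tor_residue_bound k S R I pi quotR linS K G H l j.
have part2 i : (0 < i)%N ->
    (reg_upto RS i <= reg_upto RS i.-1 + reg_upto kR i.+1 + 1%:E)%E.
  move=> i0; apply: reg_upto_le => i' j le h.
  (* On or below the diagonal nonnegativity of the right-hand side suffices; it comes from Tor_0 in
     degree 0. *)
  have [ji|ij] := leP j i'%:Z.
    apply: (@le_trans _ _ 0%E); first by rewrite lee_fin subr_le0.
    by rewrite !adde_ge0 ?lee_fin// reg_upto_ge0.
  have [l [q [a [b [e l2 eab ha hb]]]]] := boundRS _ _ h ij.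
  have -> : j - i'%:Z = (b - q%:Z) + (a - l%:Z) + 1 by lia.
  by rewrite !EFinD; apply: leeD => //; apply: leeD; rewrite -EFinD; apply: Tor_le_reg => //; lia.
(* Both halves of (3) at once: [m] will be [i] or the projective dimension, and either one bounds
   the [q] that can occur. *)
have part3 m i : (0 < i)%N -> (0 < reg_upto RS m)%E ->
    (forall q b, (0 < q <= i)%N -> Tor_neq0 RS q b -> (q <= m)%N) ->
    (reg_upto kR i.+1 <= reg_upto RS m + reg_upto kR i.-1 - 1%:E)%E.
  move=> i0 m0 hm; apply: reg_upto_le => l j le h; rewrite leeBrDr//.
  have [jl|lj] := leP j l%:Z.
    (* Regularities are integers or infinite, so positivity absorbs the -1. *)
    have m1 : (1%:E <= reg_upto RS m)%E.
      by case: (reg_upto RS m) m0 => [r| |]//; rewrite ?leey// lte_fin lee_fin; lia.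
    rewrite addeC; apply: leeD => //.
    apply: (@le_trans _ _ 0%E); first by rewrite lee_fin subr_le0.
    exact: reg_upto_ge0.
  have [c [q [a [b [e q0 eab ha hb]]]]] := boundkR _ _ h lj.
  rewrite -EFinD; have -> : j - l%:Z + 1 = (b - q%:Z) + (a - c%:Z) by lia.
  rewrite EFinD; apply: leeD; apply: Tor_le_reg => //; last by lia.
  by apply: hm hb; lia.
have nonlin m : ~ linearly_generated I \/ (0 < reg_upto RS m)%E ->
    (forall b, Tor_neq0 RS 1 b -> (0 < m)%N) -> (0 < reg_upto RS m)%E.
  move=> [|//] /(Tor1_nonlinear quotR H)[j j2 hj] hm.
  by apply: lt_le_trans (Tor_le_reg (hm _ hj) hj); rewrite lte_fin; lia.
(* Iterating [part2] costs 1 per step and yields one summand [i]; the second one in 2i reappears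
   when [tor_top] is recovered from the regularity. *)
have part1 i : (reg_upto RS i
    <= (i%:Z)%:E + \sum_(2 <= j < i.+2) reg_upto kR j)%E.
  elim: i => [|i IH].
    rewrite big_geq// adde0; apply: reg_upto_le => i j; rewrite leqn0 => /eqP -> h.
    rewrite lee_fin subr0 leNgt; apply/negP => j0.
    by have [l [q [_ [_ [e l2 _ _ _]]]]] := boundRS _ _ h j0; lia.
  apply: le_trans (part2 i.+1 isT) _; rewrite big_nat_recr//=.
  have -> : (i.+1%:Z)%:E = ((i%:Z)%:E + 1%:E)%E :> \bar int.
    by rewrite -EFinD; congr (_%:E); lia.
  by rewrite -addeA [leRHS]addeACA [(1%:E + _)%E]addeC leeD.
split=> //.
- move=> i; apply: le_trans (tor_top_le _ _) _.
  rewrite mul2n -addnn PoszD EFinD [leLHS]addeC -addeA.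
  by rewrite leeD ?part1.
- split=> [i i0 _ h|q pq h i i0 qi].
    apply: part3 => //; first by apply: nonlin.
    by move=> q b /andP[].
  have [n [P [d [e [res pP Pn]]]] nq] := infimum_int_attained pq.
  have bound q' b : Tor_neq0 RS q' b -> (q' <= q)%N.
    move=> /(Tor_projective_dimension K res pP Pn) le.
    by have := le_trans le nq.
  apply: part3 => //; last by move=> q' b _ /bound.
  by apply: nonlin => // b /bound.
move=> reg1; have RS1 m j : Tor_neq0 RS m j -> j - m%:Z <= 1.
  move=> /(Tor_le_reg (leqnn m)) le; have := le_trans le (reg_upto_le_reg RS m).
  by rewrite reg1.
(* With reg^S(R) = 1 and, by induction, a <= c, the decomposition gives j - l = (b - q) + (a - c) -
   1 <= 0. *)
have lin l : forall j, Tor_neq0 kR l j -> j <= l%:Z.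
  elim/ltn_ind: l => l IH j h; rewrite leNgt; apply/negP => lj.
  have [c [q [a [b [e q0 eab ha hb]]]]] := boundkR _ _ h lj.
  have cl : (c < l)%N by lia.
  by have := IH c cl a ha; have := RS1 _ _ hb; lia.
apply/eqP; rewrite eq_le; apply/andP; split.
  apply: supremum_ebar_le => _ [n _ <-]; apply: reg_upto_le => i j _ h.
  by rewrite lee_fin subr_le0; apply: lin.
exact: le_trans (reg_upto_ge0 0 kR00) (reg_upto_le_reg _ _).
Qed.
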